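(* Let $R$ be a Noetherian commutative ring such that $|R|$ is not $\omega$-measurable, let $M$ be an $R$-module and let $\kappa,\lambda$ be cardinals. (i) Assume that $R$ is w-slender. If $R^{[\lambda]}$ is isomorphic to a direct summand of $R^{\kappa}$, then $\lambda<\omega$. (ii) Assume that $R$ is slender and connected, that $\kappa$ is not $\omega$-measurable, and that $M$ is not finitely generated. If $M$ is isomorphic to a direct summand of $R^{\kappa}$, then there is a cardinal $\mu$ such that $M\cong_R R^{\mu}$.
   Context: Rings are unital and non-zero; ring homomorphisms preserve $1$. For a cardinal $\kappa$, $R^{\kappa}$ is the direct product of $\kappa$ copies of $R$ and $R^{[\kappa]}$ is the direct sum of $\kappa$ copies of $R$; $e_i$ denotes the $i$-th standard unit vector. A cardinal $\kappa$ is $\omega$-measurable if $\kappa>\omega$ and there is a non-principal ultrafilter on $\kappa$ that is closed under countable intersections. A commutative ring $R$ is slender if for every $f\in\mathrm{Hom}_R(R^{\omega},R)$ the set $\{i\in\omega: f(e_i)\ne0\}$ is finite. It is w-slender if there is a ring homomorphism $\phi:R\to S$ with $S$ a commutative slender ring that is finitely presented as an $R$-module via $\phi$. A commutative ring is connected if it has no idempotents other than $0$ and $1$. *)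

(* Defs.v *)
(* A cardinal is represented by an index type: [K : Type] stands for |K|. *)
From HB Require Import structures.
From mathcomp Require Import all_boot all_order all_algebra.
From mathcomp Require Import all_classical.

Set Implicit Arguments.
Unset Strict Implicit.
Unset Printing Implicit Defensive.

Import GRing.Theory.

Local Open Scope classical_set_scope.
Local Open Scope ring_scope.

Section Modules.
Variable R : comNzRingType.

Definition module_iso (V W : lmodType R) : Prop :=
  exists f : {linear V -> W}, bijective f.

Definition submodule (V : lmodType R) (A : set V) : Prop :=
  GRing.submod_closed (mem A).

Definition direct_summand (V : lmodType R) (A : set V) : Prop :=
  submodule A /\
  exists B : set V,
    [/\ submodule B, A `&` B = [set 0] &
        [set a + b | a in A & b in B] = [set: V]].

Definition iso_to_direct_summand (W V : lmodType R) : Prop :=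
  exists A : set V, direct_summand A /\
    exists f : {linear W -> V}, injective f /\ range f = A.

Definition fin_gen_set (V : lmodType R) (A : set V) : Prop :=
  exists (n : nat) (g : 'I_n -> V),
    A = range (fun c : 'I_n -> R => \sum_(i < n) c i *: g i).

Definition fin_gen (V : lmodType R) : Prop := fin_gen_set [set: V].

Definition fin_presented (V : lmodType R) : Prop :=
  exists (n : nat) (p : {linear 'rV[R]_n -> V}),
    range p = [set: V] /\ fin_gen_set [set x | p x = 0].

Definition noetherian : Prop := forall I : set R^o, submodule I -> fin_gen_set I.

(* [R^kappa]; the scalar action is the pointwise one on [K -> R^o]. *)
Definition power (K : Type) : lmodType R := (K -> R^o) : lmodType R.

Definition unit_vec (i : nat) : power nat := fun j => (j == i)%:R.

Definition slender : Prop :=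
  forall f : {linear power nat -> R^o}, finite_set [set i | f (unit_vec i) <> 0].

Definition connected_ring : Prop :=
  forall e : R, e * e = e -> e = 0 \/ e = 1.

End Modules.

Section DirectSum.
Variables (R : comNzRingType) (L : Type).

Definition finsupp : {pred power R L} :=
  fun f => `[< finite_set [set i | f i <> 0] >].

Fact finsupp_closed : GRing.subsemimod_closed finsupp.
Proof.
split; first split.
- apply/asboolP; rewrite (_ : [set _ | _] = set0)//.
  by apply/seteqP; split => i.
- move=> f g /asboolP Hf /asboolP Hg; apply/asboolP.
  apply: (@sub_finite_set _ _ ([set i | f i <> 0] `|` [set i | g i <> 0])).
    move=> i /= fgi; apply: contrapT => /not_orP[/contrapT fi /contrapT gi].
    by apply: fgi; rewrite -[LHS]/(f i + g i) fi gi addr0.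
  by rewrite finite_setU.
- move=> a f /asboolP Hf; apply/asboolP; apply: sub_finite_set Hf.
  move=> i /= afi fi; apply: afi.
  by rewrite -[LHS]/(a *: f i) fi scaler0.
Qed.

HB.instance Definition _ :=
  GRing.isSubSemiModClosed.Build R (power R L) finsupp finsupp_closed.

(* [R^[lambda]], as the submodule of [R^lambda] of functions of finite support. *)
Record direct_sum : Type :=
  DirectSum { direct_sum_val :> power R L; _ : direct_sum_val \in finsupp }.

HB.instance Definition _ := [isSub for direct_sum_val].
HB.instance Definition _ := [Choice of direct_sum by <:].
HB.instance Definition _ := [SubChoice_isSubLmodule of direct_sum by <:].
End DirectSum.

Section RestrictionOfScalars.
Variables (R S : comNzRingType) (phi : {rmorphism R -> S}).

Definition restr_scalars (_ : R -> S) : Type := S.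

HB.instance Definition _ := GRing.Zmodule.on (restr_scalars phi).

Definition restr_scale (a : R) (x : restr_scalars phi) : restr_scalars phi :=
  (phi a * (x : S) : S).

Fact restr_scaleA a b x :
  restr_scale a (restr_scale b x) = restr_scale (a * b) x.
Proof. by rewrite /restr_scale rmorphM mulrA. Qed.

Fact restr_scale1 : left_id 1 restr_scale.
Proof. by move=> x; rewrite /restr_scale rmorph1 mul1r. Qed.

Fact restr_scaleDr : right_distributive restr_scale +%R.
Proof. by move=> a x y; rewrite /restr_scale mulrDr. Qed.

Fact restr_scaleDl x : {morph restr_scale^~ x : a b / a + b}.
Proof. by move=> a b; rewrite /restr_scale rmorphD mulrDl. Qed.

HB.instance Definition _ := GRing.Zmodule_isLmodule.Build R (restr_scalars phi)
  restr_scaleA restr_scale1 restr_scaleDr restr_scaleDl.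
End RestrictionOfScalars.

Definition w_slender (R : comNzRingType) : Prop :=
  exists (S : comNzRingType) (phi : {rmorphism R -> S}),
    slender S /\ fin_presented (restr_scalars phi : lmodType R).

Definition nonprincipal (T : Type) (U : set_system T) : Prop :=
  forall x : T, U <> principal_filter x.

Definition sigma_complete (T : Type) (U : set_system T) : Prop :=
  forall F : nat -> set T, (forall n, U (F n)) -> U (\bigcap_n F n).

Definition omega_measurable (T : Type) : Prop :=
  ~ countable [set: T] /\
  exists U : set_system T,
    [/\ UltraFilter U, nonprincipal U & sigma_complete U].

(* Main.v *)
(* (i) Let h be a linear map from R^kappa to a product of copies of S.  The
   subsets A of kappa such that h vanishes on the vectors supported in A form a
   sigma-ideal without infinite disjoint families of sets outside it, so kappa is
   a finite union of null sets and atoms, and each atom carries a countably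
   complete ultrafilter.  As |R| is not omega-measurable, h has on such an atom
   values in a cyclic module; so if all values of h have finite support, then
   these supports lie in one finite set.  This applies to the composite of a
   retraction of R^kappa onto R^[lambda] with R^[lambda] -> S^[lambda].

   (ii) If kappa is not omega-measurable either, then the idempotent matrix of a
   projection of R^kappa onto M is row-finite.  Its row space P is projective, and
   M is the dual of P, so it suffices that P is free (Bass).  Connectedness gives
   that the coordinates of P outside any finite set generate the unit ideal.  By
   noetherianity there is a functional f with f(P) maximal among those killing a
   given finite set; adding far away coordinates to f cannot enlarge f(P), whence
   f(P) = R.  This splits off free summands containing given elements, and settles
   the countably generated case; a maximality argument in the style of Kaplansky
   does the rest. *)
Require Import Defs.
From HB Require Import structures.
From mathcomp Require Import all_boot all_order all_algebra.
From mathcomp Require Import all_classical.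
From mathcomp Require Import ring.

Set Implicit Arguments.
Unset Strict Implicit.
Unset Printing Implicit Defensive.

Import GRing.Theory.

Local Open Scope classical_set_scope.
Local Open Scope ring_scope.

(** * Submodules and spans *)

Section LinearPredicate.
Variables (R : comNzRingType) (V W : lmodType R).
Implicit Types (f g : V -> W) (v : V) (a : R).

Lemma lin0 f : linear f -> f 0 = 0.
Proof.
move=> fl; have := fl 1 0 0; rewrite !scale1r addr0 => /eqP.
by rewrite -subr_eq0 opprD addrA subrr add0r oppr_eq0 => /eqP.
Qed.

Lemma linZ f a v : linear f -> f (a *: v) = a *: f v.
Proof. by move=> fl; have := fl a v 0; rewrite lin0// !addr0. Qed.

Lemma linD f u v : linear f -> f (u + v) = f u + f v.
Proof. by move=> fl; have := fl 1 u v; rewrite !scale1r. Qed.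

Lemma linB f u v : linear f -> f (u - v) = f u - f v.
Proof.
by move=> fl; rewrite linD// -scaleN1r linZ// scaleN1r.
Qed.

Lemma lin_sum f (I : Type) (r : seq I) (F : I -> V) : linear f ->
  f (\sum_(i <- r) F i) = \sum_(i <- r) f (F i).
Proof.
move=> fl; elim: r => [|i r IH]; first by rewrite !big_nil lin0.
by rewrite !big_cons linD// IH.
Qed.

Lemma lin_add f g : linear f -> linear g -> linear (fun v => f v + g v).
Proof. by move=> fl gl a u v; rewrite fl gl scalerDr addrACA. Qed.

Lemma lin_sum_scale (I : Type) (r : seq I) (h : I -> V -> R^o) (w : I -> W) :
  (forall i, linear (h i)) -> linear (fun v => \sum_(i <- r) h i v *: w i).
Proof.
move=> hl a u v; rewrite scaler_sumr -big_split; apply: eq_bigr => i _ /=.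
by rewrite hl scalerDl scalerA.
Qed.

End LinearPredicate.

Section Submodule.
Variables (R : comNzRingType) (V : lmodType R).
Implicit Types (A B U X Y Z : set V) (u v : V) (a : R).

Lemma submoduleP A : submodule A <->
  A 0 /\ forall a u v, A u -> A v -> A (a *: u + v).
Proof.
split=> [[A0 AD]|[A0 AD]].
  split; first exact/set_mem/A0.
  by move=> a u v /mem_set Au /mem_set Av; exact/set_mem/AD.
split; first exact/mem_set.
by move=> a u v /set_mem Au /set_mem Av; exact/mem_set/AD.
Qed.

Lemma submod0 A : submodule A -> A 0.
Proof. by case/submoduleP. Qed.

Lemma submod_lin A a u v : submodule A -> A u -> A v -> A (a *: u + v).
Proof. by case/submoduleP => _; apply. Qed.

Lemma submodD A u v : submodule A -> A u -> A v -> A (u + v).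
Proof. by move=> sA Au Av; rewrite -[u]scale1r; apply: submod_lin. Qed.

Lemma submodZ A a u : submodule A -> A u -> A (a *: u).
Proof. by move=> sA Au; rewrite -[_ *: _]addr0; apply: submod_lin => //; apply: submod0. Qed.

Lemma submodB A u v : submodule A -> A u -> A v -> A (u - v).
Proof. by move=> sA Au Av; apply: submodD => //; rewrite -scaleN1r; apply: submodZ. Qed.

Lemma submod_sum A (I : eqType) (r : seq I) (F : I -> V) : submodule A ->
  (forall i, i \in r -> A (F i)) -> A (\sum_(i <- r) F i).
Proof.
move=> sA AF; rewrite big_seq; apply: (big_ind A) => //; first exact: submod0.
by move=> u v; apply: submodD.
Qed.

End Submodule.

Lemma ker_submod (R : comNzRingType) (V W : lmodType R) (f : V -> W) :
  linear f -> submodule [set v | f v = 0].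
Proof.
move=> fl; apply/submoduleP; split; first exact: lin0.
by move=> a u v /= fu fv; rewrite fl fu fv scaler0 addr0.
Qed.

Lemma image_submod (R : comNzRingType) (V W : lmodType R) (f : V -> W) (A : set V) :
  linear f -> submodule A -> submodule (f @` A).
Proof.
move=> fl sA; apply/submoduleP; split.
  by exists 0; [exact: submod0|exact: lin0].
move=> a _ _ [u Au <-] [v Av <-]; exists (a *: u + v); last by rewrite fl.
exact: (submod_lin _ sA).
Qed.

Section Span.
Variables (R : comNzRingType) (V : lmodType R).
Implicit Types (A B U X Y Z : set V) (u v : V) (a : R).

(** As an intersection of submodules the span comes with an induction principle: a property that
    defines a submodule containing [X] holds on all of it. *)
Definition lspan X : set V :=
  [set v | forall A, submodule A -> X `<=` A -> A v].

Lemma lspan_submod X : submodule (lspan X).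
Proof.
apply/submoduleP; split=> [A sA _|a u v uX vX A sA XA]; first exact: submod0.
by apply: submod_lin => //; [exact: uX|exact: vX].
Qed.

Lemma sub_lspan X : X `<=` lspan X.
Proof. by move=> x Xx A _; apply. Qed.

Lemma lspan_min A X : submodule A -> X `<=` A -> lspan X `<=` A.
Proof. by move=> sA XA v; apply. Qed.

Lemma lspanS X Y : X `<=` Y -> lspan X `<=` lspan Y.
Proof.
by move=> XY; apply: lspan_min (lspan_submod Y) _ => x /XY; apply: sub_lspan.
Qed.

Lemma lspan_subP X Y : X `<=` lspan Y -> lspan X `<=` lspan Y.
Proof. by move=> XY; apply: lspan_min XY; exact: lspan_submod. Qed.

Lemma lspanU X Y v : lspan (X `|` Y) v ->
  exists x y, [/\ lspan X x, lspan Y y & v = x + y].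
Proof.
move=> XYv; pattern v; refine (XYv _ _ _) => {v XYv}; last first.
  move=> x [Xx|Yx].
    exists x, 0; rewrite addr0; split=> //; first exact: sub_lspan.
    exact: submod0 (lspan_submod _).
  exists 0, x; rewrite add0r; split=> //; first exact: submod0 (lspan_submod _).
  exact: sub_lspan.
apply/submoduleP; split.
  by exists 0, 0; rewrite addr0; split=> //; exact: submod0 (lspan_submod _).
move=> a _ _ [x [y [Xx Yy ->]]] [x' [y' [Xx' Yy' ->]]].
exists (a *: x + x'), (a *: y + y'); split; last first.
- by rewrite scalerDr addrACA.
- exact: submod_lin (lspan_submod _) Yy Yy'.
- exact: submod_lin (lspan_submod _) Xx Xx'.
Qed.

Lemma lspan_finP X v : lspan X v -> exists r : seq V, exists c : V -> R,
  [/\ uniq r, [set` r] `<=` X & v = \sum_(x <- r) c x *: x].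
Proof.
move=> Xv; pattern v; refine (Xv _ _ _) => {v Xv}; last first.
  move=> x Xx; exists [:: x], (fun=> 1); split=> //; last first.
    by rewrite big_seq1 scale1r.
  by move=> y; rewrite /= inE => /eqP ->.
apply/submoduleP; split.
  by exists [::], (fun=> 0); split=> //; rewrite big_nil.
move=> a _ _ [r [c [ur rX ->]]] [r' [c' [ur' rX' ->]]].
exists (undup (r ++ r')).
exists (fun x => a * (if x \in r then c x else 0) + (if x \in r' then c' x else 0)).
split; first exact: undup_uniq.
  by move=> x; rewrite /= mem_undup mem_cat => /orP[/rX|/rX'].
have E (t : seq V) (d : V -> R) : uniq t -> {subset t <= undup (r ++ r')} ->
    \sum_(x <- t) d x *: x =
    \sum_(x <- undup (r ++ r')) (if x \in t then d x else 0) *: x.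
  move=> ut tr; rewrite [RHS](bigID (fun x => x \in t)) /= [X in _ + X]big1 ?addr0;
    last first.
    by move=> x /negbTE ->; rewrite scale0r.
  rewrite [RHS](eq_bigr (fun x => d x *: x)) => [|x ->//]; rewrite -[RHS]big_filter.
  apply: perm_big; apply: uniq_perm => //; first by rewrite filter_uniq ?undup_uniq.
  move=> x; rewrite mem_filter; have [xt|//] := boolP (x \in t).
  by rewrite tr.
rewrite (E r)// ?(E r')//; first last.
- by move=> x xr; rewrite mem_undup mem_cat xr.
- by move=> x xr; rewrite mem_undup mem_cat xr orbT.
rewrite scaler_sumr -big_split; apply: eq_bigr => x _ /=.
by rewrite scalerDl scalerA.
Qed.

(** For a submodule [U] this is linear independence of the images of [Z] in the quotient by [U]. *)
Definition indep U Z :=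
  forall z a, Z z -> lspan (U `|` Z `\ z) (a *: z) -> a = 0.

Lemma indep_sum U Z (r : seq V) (c : V -> R) : submodule U -> indep U Z ->
  uniq r -> [set` r] `<=` Z -> U (\sum_(z <- r) c z *: z) ->
  forall z, z \in r -> c z = 0.
Proof.
move=> sU iZ ur rZ Us z zr; apply: (iZ z); first exact: rZ.
have E : c z *: z =
    \sum_(x <- r) c x *: x - \sum_(x <- r | x != z) c x *: x.
  by rewrite (bigD1_seq z)//= addrK.
rewrite E; apply: submodB (lspan_submod _) _ _; first by apply: sub_lspan; left.
rewrite -big_filter; apply: submod_sum (lspan_submod _) _ => x.
rewrite mem_filter => /andP[xz xr]; apply: submodZ (lspan_submod _) _.
by apply: sub_lspan; right; split; [exact: rZ|exact/eqP].
Qed.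

Lemma indep_lspan0 U Z v : submodule U -> indep U Z -> lspan Z v -> U v -> v = 0.
Proof.
move=> sU iZ /lspan_finP[r [c [ur rZ ->]]] Uv.
rewrite big_seq big1// => z zr.
by rewrite (indep_sum sU iZ ur rZ Uv zr) scale0r.
Qed.

(** In a relation at some [z] in [X], the part in the span of [Z] lies in [U], so it vanishes by
    independence modulo [U]. *)
Lemma indepU U X Z : submodule U -> X `<=` U -> indep [set 0] X -> indep U Z ->
  indep [set 0] (X `|` Z).
Proof.
move=> sU XU iX iZ z a XZz H.
have [Zz|nZz] := pselect (Z z).
  apply: (iZ z) => //; apply: lspanS H => y [->|[[Xy|Zy] yz]].
  - by left; apply: submod0.
  - by left; apply: XU.
  - by right.
have Xz : X z by case: XZz.
have [x [y [Xx Zy E]]] : exists x y,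
    [/\ lspan ([set 0] `|` X `\ z) x, lspan Z y & a *: z = x + y].
  apply/lspanU; apply: lspanS H => y [->|[[Xy|Zy] yz]].
  - by left; left.
  - by left; right.
  - by right.
have y0 : y = 0.
  apply: (indep_lspan0 sU iZ Zy).
  have -> : y = a *: z - x by rewrite E addrAC subrr add0r.
  apply: (submodB sU (submodZ _ sU (XU _ Xz))).
  apply: (lspan_min sU _ Xx) => u [->|[Xu _]]; first exact: submod0.
  exact: XU.
by apply: (iX z) => //; rewrite E y0 addr0.
Qed.

(** A given relation involves finitely many elements, so it already holds in one member of the
    family. *)
Lemma indep_directed (T : Type) (D : set T) (X : T -> set V) U :
  (forall i, D i -> indep U (X i)) ->
  (forall i j, D i -> D j -> exists k, [/\ D k, X i `<=` X k & X j `<=` X k]) ->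
  indep U (\bigcup_(i in D) X i).
Proof.
move=> iX dirX z a [i0 Di0 Xz] az.
suff [k [Dk X0k Xk]] : exists k, [/\ D k, X i0 `<=` X k &
    lspan (U `|` X k `\ z) (a *: z)].
  by apply: (iX k Dk z) => //; exact: X0k.
move: (a *: z) az => v Xv; pattern v; refine (Xv _ _ _) => {v Xv}.
- apply/submoduleP; split.
    by exists i0; split=> //; exact: submod0 (lspan_submod _).
  move=> b u v [k [Dk Xk ku]] [l [Dl Xl lv]].
  have [m [Dm km lm]] := dirX k l Dk Dl.
  exists m; split=> //; first by apply: subset_trans km.
  apply: (submod_lin _ (lspan_submod _)).
    by apply: lspanS ku => y [|[/km]]; [left|right].
  by apply: lspanS lv => y [|[/lm]]; [left|right].
- move=> y [Uy|[[i Di Xy] yz]].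
    by exists i0; split=> //; apply: sub_lspan; left.
  have [m [Dm im i0m]] := dirX i i0 Di Di0.
  by exists m; split=> //; apply: sub_lspan; right; split=> //; exact: im.
Qed.

End Span.

(** * Noetherian rings *)

Section Noetherian.
Variable R : comNzRingType.
Hypothesis noethR : noetherian R.
Implicit Types (I J p : set R^o) (a b r : R).

Lemma ideal_mull I r a : submodule I -> I a -> I (r * a).
Proof. exact: submodZ. Qed.

Lemma ideal_mulr I r a : submodule I -> I a -> I (a * r).
Proof. by rewrite mulrC; apply: ideal_mull. Qed.

Lemma noetherian_gens I : submodule I -> exists n (g : 'I_n -> R),
  (forall i, I (g i)) /\
  forall a, I a -> exists c : 'I_n -> R, a = \sum_(i < n) c i * g i.
Proof.
move=> /[dup] sI /noethR[n [g Ig]]; exists n, g; split.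
  move=> i; rewrite Ig; exists (fun j => (j == i)%:R) => //.
  rewrite (bigD1 i)//= eqxx scale1r big1 ?addr0// => j /negbTE ->.
  by rewrite scale0r.
by move=> a; rewrite {1}Ig => -[c _ <-]; exists c.
Qed.

(** Otherwise choice yields a strictly ascending chain of ideals, whose finitely generated union
    equals one of its members. Indexing the ideals by [T] returns a maximal one together with the
    functional or list defining it. *)
Lemma noetherian_max (T : Type) (I : T -> set R^o) (Q : T -> Prop) t0 :
  (forall t, Q t -> submodule (I t)) -> Q t0 ->
  exists2 t, Q t & forall t', Q t' -> I t `<=` I t' -> I t' `<=` I t.
Proof.
move=> sI Qt0; apply: contrapT => /forall2NP nomax.
have nxP (t : {t | Q t}) : exists t' : {t | Q t},
    I (sval t) `<=` I (sval t') /\ ~ (I (sval t') `<=` I (sval t)).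
  case: t => t Qt /=; have [//|] := nomax t.
  move/existsNP => [t' /not_implyP[Qt' /not_implyP[tt' t't]]].
  by exists (exist _ t' Qt').
have [nx nx1] := choice nxP.
pose u k := iter k nx (exist _ t0 Qt0).
pose J k := I (sval (u k)).
have Jmon k l : (k <= l)%N -> J k `<=` J l.
  move=> /subnK <-; elim: (l - k)%N => // j IH x /IH.
  by rewrite addSn /J /u /=; apply: (nx1 _).1.
have sJ k : submodule (J k) by apply: sI; exact: (svalP (u k)).
have /noetherian_gens[n [g [gJ JE]]] : submodule (\bigcup_k J k).
  apply/submoduleP; split; first by exists 0%N => //; exact: submod0 (sJ 0%N).
  move=> a x y [k _ Jx] [l _ Jy]; exists (maxn k l) => //.
  apply: (submod_lin _ (sJ _)).
  - by apply: Jmon Jx; rewrite leq_maxl.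
  - by apply: Jmon Jy; rewrite leq_maxr.
have [k Jk] : exists k, forall i, J k (g i).
  have /choice[e eP] i : exists k, J k (g i) by have [k _] := gJ i; exists k.
  exists (\max_(i < n) e i) => i; apply: Jmon (eP i).
  exact: (leq_bigmax_cond (F := e)).
have [_ nJ] := nx1 (u k); apply: nJ => x Jx.
have /JE[c ->] : (\bigcup_k J k) x by exists k.+1.
apply: (@submod_sum R R^o) => [|i _]; first exact: sI (svalP (u k)).
exact: ideal_mull (sI _ (svalP (u k))) (Jk i).
Qed.

Definition prime_ideal p :=
  [/\ submodule p, ~ p 1 & forall a b, p (a * b) -> p a \/ p b].

Lemma ideal_adjoin I r : submodule I ->
  submodule [set x : R^o | exists2 y, I y & exists s, x = y + s * r].
Proof.
move=> sI; apply/submoduleP; split.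
  by exists 0; [exact: submod0|exists 0; rewrite mul0r addr0].
move=> a _ _ [y Iy [s ->]] [y' Iy' [s' ->]]; exists (a * y + y').
  exact: submod_lin.
by exists (a * s + s'); rewrite /GRing.scale /=; ring.
Qed.

(** Elements outside a maximal proper ideal above [I] are units modulo it, so a product of two of
    them stays outside. *)
Lemma prime_above I : submodule I -> ~ I 1 ->
  exists2 p, prime_ideal p & I `<=` p.
Proof.
move=> sI I1.
have [||p [sp Ip p1] pmax] := @noetherian_max (set R^o) id
    (fun p => [/\ submodule p, I `<=` p & ~ p 1]) I.
- by move=> p [].
- by split.
exists p => //; split=> // a b pab; apply: contrapT => /not_orP[pa pb].
have H r : ~ p r -> exists2 y, p y & exists s, 1 = y + s * r.
  move=> pr; apply: contrapT => H1; apply: pr.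
  pose q := [set x : R^o | exists2 y, p y & exists s, x = y + s * r].
  apply: (pmax q); last first.
  - by exists 0; [exact: submod0|exists 1; rewrite mul1r add0r].
  - by move=> y py; exists y => //; exists 0; rewrite mul0r addr0.
  - split=> //; first exact: ideal_adjoin.
    by move=> y /Ip py; exists y => //; exists 0; rewrite mul0r addr0.
have [y py [s E]] := H a pa; have [y' py' [s' E']] := H b pb.
apply: p1; rewrite -[1]mulr1 {1}E E'.
have -> : (y + s * a) * (y' + s' * b) =
  (y' + s' * b) * y + (s * a * y' + s * s' * (a * b)) by ring.
by apply: (submodD sp); [|apply: (submodD sp)]; apply: (ideal_mull _ sp).
Qed.

(** Nakayama's lemma localised at [p], with denominators cleared. The first relation expresses
    [(d - c ord0) * t ord0] through the other [t j], with [d - c ord0] outside [p]; multiplying the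
    other relations by this factor eliminates [t ord0]. *)
Lemma nakayama_prime p n (t : 'I_n -> R) (d : R) : prime_ideal p -> ~ p d ->
  (forall j, exists2 c : 'I_n -> R,
     (forall i, p (c i)) & d * t j = \sum_(i < n) c i * t i) ->
  exists2 r, ~ p r & forall j, r * t j = 0.
Proof.
move=> [sp p1 pM]; elim: n t d => [|n IH] t d pd H.
  by exists 1 => // -[].
have [c pc E0] := H ord0.
have pdc : ~ p (d - c ord0).
  by move=> pdc; apply: pd; rewrite -[d](subrK (c ord0)); apply: (submodD sp).
have E0' : (d - c ord0) * t ord0 = \sum_(i < n) c (lift ord0 i) * t (lift ord0 i).
  by rewrite mulrBl E0 big_ord_recl addrC addKr.
have [|j|r pr rt] := IH (fun i => t (lift ord0 i)) ((d - c ord0) * d).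
- by move/pM => -[].
- have [c' pc' Ej] := H (lift ord0 j).
  exists (fun i => (d - c ord0) * c' (lift ord0 i) + c' ord0 * c (lift ord0 i)).
    by move=> i; apply: (submodD sp); [exact: (ideal_mull _ sp)|exact: (ideal_mulr _ sp)].
  rewrite -mulrA Ej big_ord_recl mulrDr mulrCA E0' !mulr_sumr -big_split /=.
  by apply: eq_bigr => i _; ring.
exists (r * (d - c ord0)); first by move/pM => -[].
move=> j; have [i ->|->] := unliftP ord0 j.
  by rewrite mulrAC rt mul0r.
rewrite -mulrA E0' mulr_sumr big1// => i _.
by rewrite mulrCA rt mulr0.
Qed.

End Noetherian.

(** * Splitting off elements of projective modules *)

Lemma In_cat (T : Type) (y : T) (a b : seq T) :
  List.In y (a ++ b) <-> List.In y a \/ List.In y b.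
Proof.
elim: a => [|x a IH] /=; first by split; [right|case].
by rewrite IH; split=> [[|[|]]|[[|]|]]; tauto.
Qed.

Lemma In_map (T : eqType) (T' : Type) (f : T -> T') (y : T') (r : seq T) :
  List.In y (map f r) <-> exists2 x, x \in r & y = f x.
Proof.
elim: r => [|x r IH] /=; first by split=> // -[].
rewrite IH; split=> [[<-|[z zr ->]]|[z]].
- by exists x; rewrite ?inE ?eqxx.
- by exists z; rewrite // inE zr orbT.
- by rewrite inE => /predU1P[->|zr] ->; [left|right; exists z].
Qed.

Definition functional_mod (R : comNzRingType) (V : lmodType R) (U : set V)
    (f : V -> R^o) : Prop :=
  linear f /\ forall u, U u -> f u = 0.

(** For finite [Z] these functionals split the span of [Z] off as a free summand modulo [U]. *)
Definition dual_set (R : comNzRingType) (V : lmodType R) (U Z : set V) : Prop :=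
  forall z, Z z -> exists f : V -> R^o,
    [/\ functional_mod U f, f z = 1 & forall z', Z z' -> z' <> z -> f z' = 0].

(* Working modulo [U] throughout avoids forming the quotient [W / U]. *)
Record dual_basis (R : comNzRingType) (V : lmodType R) (I : eqType)
    (U W : set V) (g : I -> V) (s : I -> V -> R^o) : Prop := DualBasis {
  db_submodl : submodule U;
  db_submodr : submodule W;
  db_sub : U `<=` W;
  db_gen : forall i, W (g i);
  db_functional : forall i, functional_mod U (s i);
  db_expand : forall x, W x -> exists r : seq I,
    [/\ uniq r, forall i, i \notin r -> s i x = 0 &
        U (x - \sum_(i <- r) s i x *: g i)] }.

(** For a dual basis this says that [W] modulo [U] is not finitely generated, since each element has
    finitely many nonzero coordinates. *)
Definition unbounded (R : comNzRingType) (V : lmodType R) (I : eqType)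
    (W : set V) (s : I -> V -> R^o) : Prop :=
  forall t : seq I, exists i x, [/\ i \notin t, W x & s i x <> 0].

Section DualBasis.
Variables (R : comNzRingType) (V : lmodType R) (I : eqType).
Variables (U W : set V) (g : I -> V) (s : I -> V -> R^o).
Hypothesis db : dual_basis U W g s.

Let sU : submodule U. Proof. exact: db_submodl db. Qed.
Let sW : submodule W. Proof. exact: db_submodr db. Qed.
Let Wg i : W (g i). Proof. exact: db_gen db i. Qed.
Let sl i : linear (s i). Proof. by have [] := db_functional db i. Qed.
Let sU0 i u : U u -> s i u = 0. Proof. by have [_] := db_functional db i; apply. Qed.

Lemma functional_expand x : W x -> exists r : seq I,
  [/\ uniq r, forall i, i \notin r -> s i x = 0 &
      forall f, functional_mod U f -> f x = \sum_(i <- r) s i x * f (g i)].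
Proof.
move=> /(db_expand db)[r [ur r0 rU]]; exists r; split=> // f [fl fU].
move: (fU _ rU); rewrite linB// lin_sum// => /eqP; rewrite subr_eq0.
by move=> /eqP ->; apply: eq_bigr => i _; rewrite linZ.
Qed.

Lemma coord_finite x : W x -> exists r : seq I, forall i, i \notin r -> s i x = 0.
Proof. by move=> /(db_expand db)[r [_ r0 _]]; exists r. Qed.

Lemma coord_finite_seq (X : seq V) : [set` X] `<=` W ->
  exists r : seq I, forall i x, i \notin r -> x \in X -> s i x = 0.
Proof.
elim: X => [|x X IH] XW; first by exists [::].
have [r rX] : exists r : seq I, forall i x, i \notin r -> x \in X -> s i x = 0.
  by apply: IH => y yX; apply: XW; rewrite /= inE yX orbT.
have [r' rx] : exists r : seq I, forall i, i \notin r -> s i x = 0.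
  by apply: coord_finite; apply: XW; rewrite /= inE eqxx.
exists (r ++ r') => i y; rewrite mem_cat negb_or => /andP[ir ir'].
by rewrite inE => /predU1P[->|/rX]; [apply: rx|apply].
Qed.

Definition coord_ideal (t : seq I) : set R^o :=
  lspan [set a | exists i x, [/\ i \notin t, W x & a = s i x]].

(* Gaussian elimination at the prime [p]: [L] is, up to the unit [d] at [p],
   the projection along finitely many vectors split off from [W]. *)
Lemma eliminate (p : set R^o) (t : seq I) : prime_ideal p ->
  exists (d : R) (L : V -> V), [/\ ~ p d, linear L /\ (forall w, L (L w) = d *: L w),
    (forall w, W w -> W (L w)) /\ (forall u, U u -> U (L u)),
    (exists t' : seq I, forall i w, i \notin t' -> W w -> s i (L w) = d * s i w) &
    forall i w, i \in t -> W w -> p (s i (L w))].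
Proof.
move=> [sp p1 pM]; elim: t => [|i t [d [L [pd [Ll LL] [LW LU] [t' Lt'] Lt]]]].
  exists 1, id; split=> //; first by split=> // w; rewrite scale1r.
  by exists [::] => i w _ _; rewrite mul1r.
have [iL|/existsNP[z /not_implyP[Wz pz]]] :=
    pselect (forall w, W w -> p (s i (L w))).
  exists d, L; split=> //; first by exists t'.
  by move=> j w; rewrite inE => /predU1P[-> /iL|/Lt]; last exact.
pose x := L z; pose a := s i x.
have Lx : L x = d *: x by exact: LL.
(* A projection along [x] cleared of the denominator [a], which lies outside [p]: it makes
   coordinate [i] zero, and away from the finite support of [x] it only multiplies the coordinates
   of [L w] by [a]. *)
pose L' w := a *: L w - s i (L w) *: x.
have Wx : W x by exact: LW.
have L'l : linear L'.
  move=> b u v; rewrite /L' Ll sl scalerDr scalerDl scalerBr !scalerA opprD.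
  by rewrite (mulrC a) addrACA.
exists (a * d), L'; split=> //.
- by move/pM => -[].
- split=> // w; rewrite /L'.
  have -> : L (a *: L w - s i (L w) *: x) = d *: (a *: L w - s i (L w) *: x).
    rewrite (linB _ _ Ll) !(linZ _ _ Ll) LL Lx scalerBr.
    by rewrite !scalerA (mulrC d a) (mulrC d (s i (L w))).
  rewrite (linZ _ _ (sl i)) (linB _ _ (sl i)) !(linZ _ _ (sl i)).
  rewrite -/a (_ : a *: s i (L w) - _ = 0) ?scaler0 ?scale0r ?subr0 ?scalerA//.
  by rewrite /GRing.scale /= mulrC subrr.
- split=> [w Ww|u Uu].
    by apply: (submodB sW); apply: (submodZ _ sW) => //; exact: LW.
  by rewrite /L' sU0 ?scale0r ?subr0; [apply: (submodZ _ sU)|]; exact: LU.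
- have [r rx] := coord_finite Wx.
  exists (t' ++ r) => j w; rewrite mem_cat negb_or => /andP[jt' jr] Ww.
  rewrite /L' (linB _ _ (sl j)) !(linZ _ _ (sl j)) rx// scaler0 subr0 Lt'//.
  by rewrite /GRing.scale /= mulrA.
- move=> j w jt Ww; rewrite /L' (linB _ _ (sl j)) !(linZ _ _ (sl j)) /GRing.scale /=.
  move: jt; rewrite inE => /predU1P[->|jt].
    by rewrite -/a mulrC subrr; exact: (submod0 sp).
  by apply: (submodB sp); apply: (ideal_mull _ sp); exact: Lt.
Qed.

Hypothesis noethR : noetherian R.

(** After elimination all coordinates of all [L w] lie in [p]. Expanding [L w] once more gives
    [d * T] inside [p * T] for the ideal [T] they generate, so some [r] outside [p] kills [T] by
    Nakayama; far away, [s i (L w)] is [d * s i w]. *)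
Lemma coord_ideal_local (p : set R^o) (t : seq I) : prime_ideal p ->
  coord_ideal t `<=` p ->
  exists2 r, ~ p r & exists t' : seq I,
    forall i w, i \notin t' -> W w -> r * s i w = 0.
Proof.
move=> pp Jp; have [d [L [pd [Ll LL] [LW LU] [t' Lt'] Lt]]] := eliminate t pp.
have [sp p1 pM] := pp.
have Lp i w : W w -> p (s i (L w)).
  move=> Ww; have [it|it] := boolP (i \in t); first exact: Lt.
  by apply: Jp; apply: sub_lspan; exists i, (L w); split=> //; exact: LW.
pose T : set R^o := lspan [set a | exists i w, W w /\ a = s i (L w)].
have [n [c [cT TE]]] := noetherian_gens noethR (lspan_submod _ : submodule T).
pose S : set R^o := [set a | exists2 b : 'I_n -> R,
  (forall k, p (b k)) & d * a = \sum_(k < n) b k * c k].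
have sS : submodule S.
  apply/submoduleP; split.
    exists (fun=> 0); first by move=> _; exact: (submod0 sp).
    by rewrite mulr0 big1// => k _; rewrite mul0r.
  move=> a u v [b pb bE] [b' pb' bE']; exists (fun k => a * b k + b' k).
    by move=> k; apply: (submod_lin _ sp).
  rewrite /GRing.scale /= mulrDr mulrCA bE bE' mulr_sumr -big_split /=.
  by apply: eq_bigr => k _; ring.
have TS : T `<=` S.
  apply: lspan_min => // _ [i [w [Ww ->]]].
  have [r [_ _ rE]] := functional_expand (LW _ Ww).
  have LsU : functional_mod U (fun v => s i (L v)).
    by split=> [b u v|u Uu]; [rewrite Ll sl|rewrite sU0//; exact: LU].
  have := rE _ LsU; rewrite LL linZ// /S /= => E.
  have /choice[b bE] j : exists b : 'I_n -> R, s j (L w) = \sum_(k < n) b k * c k.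
    by apply: TE; apply: sub_lspan; exists j, w.
  exists (fun k => \sum_(j <- r) s i (L (g j)) * b j k).
    move=> k; apply: (@submod_sum R R^o p) => // j _.
    by apply: (ideal_mulr _ sp); apply: Lp.
  rewrite -[LHS]/(d *: s i (L w)) E; under eq_bigr do rewrite bE mulr_suml.
  rewrite exchange_big /=; apply: eq_bigr => k _; rewrite mulr_suml.
  by apply: eq_bigr => j _; ring.
have [k|r pr rc] := nakayama_prime (t := c) pp pd.
  by apply: TS; exact: cT.
exists (r * d); first by move/pM => -[].
exists t' => i w it' Ww; rewrite -mulrA -Lt'//.
have /TE[b ->] : T (s i (L w)) by apply: sub_lspan; exists i, w.
by rewrite mulr_sumr big1// => k _; rewrite mulrCA rc mulr0.
Qed.

Hypotheses (connR : connected_ring R) (bigW : unbounded W s).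

(* The ideal [K] of the elements killing almost all coordinates annihilates some
   [coord_ideal t0]; by the local statement the two are comaximal, hence
   generated by complementary idempotents. *)
Lemma coord_ideal_full (t : seq I) : coord_ideal t 1.
Proof.
pose K : set R^o :=
  [set r | exists t' : seq I, forall i w, i \notin t' -> W w -> r * s i w = 0].
have sK : submodule K.
  apply/submoduleP; split; first by exists [::] => i w _ _; rewrite mul0r.
  move=> a u v [t1 ut1] [t2 vt2]; exists (t1 ++ t2) => i w.
  rewrite mem_cat negb_or => /andP[it1 it2] Ww.
  by rewrite /GRing.scale /= mulrDl -mulrA ut1 ?vt2 ?mulr0 ?addr0.
have [t0 Kt0] : exists t0 : seq I,
    forall r i w, K r -> i \notin t0 -> W w -> r * s i w = 0.
  have [n [c [cK KE]]] := noetherian_gens noethR sK.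
  have [e eP] := choice cK.
  exists (flatten [seq e k | k <- enum 'I_n]) => r i w /KE[b ->] ie Ww.
  rewrite mulr_suml big1// => k _; rewrite -mulrA eP ?mulr0//.
  apply: contra ie => ie; apply/flattenP; exists (e k) => //.
  by apply/mapP; exists k => //; rewrite mem_enum.
pose t1 := t ++ t0.
have sJ : submodule (coord_ideal t1) by exact: lspan_submod.
have KJ r j : K r -> coord_ideal t1 j -> r * j = 0.
  move=> Kr /(_ [set j | r * j = 0]); apply.
    apply/submoduleP; split=> [|a u v /= ru rv]; first exact: mulr0.
    by rewrite mulrDr /GRing.scale /= mulrCA ru rv mulr0 addr0.
  move=> _ [i [w [it1 Ww ->]]]; apply: Kt0 => //.
  by move: it1; rewrite mem_cat negb_or => /andP[].
have JJ : coord_ideal t1 `<=` coord_ideal t.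
  apply: lspanS => _ [i [w [it1 Ww ->]]]; exists i, w; split=> //.
  by move: it1; rewrite mem_cat negb_or => /andP[].
suff [k [j [Kk Jj E]]] : exists k j, [/\ K k, coord_ideal t1 j & k + j = 1].
  have kk : k * k = k by rewrite -[in RHS](mulr1 k) -E mulrDr (KJ k j)// addr0.
  have [k0|k1] := connR kk; first by apply: JJ; rewrite -E k0 add0r.
  have [i [x [it0 Wx []]]] := bigW t0.
  by rewrite -[s i x]mul1r -k1 Kt0.
apply: contrapT => H.
pose S : set R^o := [set x | exists k j, [/\ K k, coord_ideal t1 j & k + j = x]].
have sS : submodule S.
  apply/submoduleP; split.
    exists 0, 0; split; [exact: submod0 sK|exact: submod0 sJ|exact: addr0].
  move=> a _ _ [k [j [Kk Jj <-]]] [k' [j' [Kk' Jj' <-]]].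
  exists (a *: k + k'), (a *: j + j'); split.
  - exact: (submod_lin _ sK).
  - exact: (submod_lin _ sJ).
  - by rewrite /GRing.scale /=; ring.
have [p pp Sp] := prime_above noethR sS H.
have [r pr rK] : exists2 r, ~ p r & K r.
  apply: (coord_ideal_local (t := t1)) pp _ => j Jj; apply: Sp.
  by exists 0, j; split=> //; [exact: submod0 sK|rewrite add0r].
by apply: pr; apply: Sp; exists r, 0; split=> //; [exact: submod0 sJ|rewrite addr0].
Qed.

(** A coordinate [s i] vanishing on [X] and on preimages of generators of f(W) can be added to [f]
    without shrinking the image, so by maximality its values lie in f(W). Such values generate the
    unit ideal. *)
Lemma split_off_functional (X : seq V) : [set` X] `<=` W ->
  exists f b, [/\ functional_mod U f, (forall x, x \in X -> f x = 0), W b & f b = 1].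
Proof.
move=> XW.
pose Q (f : V -> R^o) := functional_mod U f /\ forall x, x \in X -> f x = 0.
have [||f [[fl fU] fX] fmax] :=
    @noetherian_max R noethR (V -> R^o) (fun f => f @` W) Q (fun=> 0).
- by move=> f [[fl fU] fX]; exact: image_submod.
- by split=> //; split=> // a u v; rewrite scaler0 addr0.
have sfW : submodule (f @` W) by exact: image_submod.
have [n [c [cW cE]]] := noetherian_gens noethR sfW.
have /choice[w wP] k : exists w, W w /\ f w = c k.
  by have [w Ww <-] := cW k; exists w.
have [r rP] : exists r : seq I, forall i x, i \notin r ->
    x \in X ++ [seq w k | k <- enum 'I_n] -> s i x = 0.
  apply: coord_finite_seq => x; rewrite /= mem_cat => /orP[/XW//|/mapP[k _ ->]].
  by have [] := wP k.
have [b Wb fb] : (f @` W) 1.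
  have := @coord_ideal_full r; apply: (lspan_min sfW) => _ [i [x [ir Wx ->]]].
  pose f' : V -> R^o := fun v => f v + s i v.
  have f'l : linear f' by exact: lin_add.
  have f'w k : f' (w k) = c k.
    rewrite /f' (rP i) ?addr0//; first by have [] := wP k.
    by rewrite mem_cat map_f ?orbT// mem_enum.
  have : (f' @` W) `<=` (f @` W).
    apply: fmax.
      split; first by split=> // u Uu; rewrite /f' fU// sU0// addr0.
      by move=> y yX; rewrite /f' fX// (rP i)// ?addr0// mem_cat yX.
    move=> a /cE[e ->]; exists (\sum_(k < n) e k *: w k).
      by apply: submod_sum sW _ => k _; apply: (submodZ _ sW); have [] := wP k.
    by rewrite lin_sum//; apply: eq_bigr => k _; rewrite linZ// f'w.
  move=> /(_ (f' x)) [|y Wy yE]; first by exists x.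
  exists (y - x); first exact: submodB sW Wy Wx.
  by rewrite linB// yE /f' addrAC subrr add0r.
by exists f, b.
Qed.

(** Induction on [Y]. Among the finite lists [Z] in [W] killed by the tail of [Y], take one for
    which [y] has maximal image on the span. With [f] vanishing on [Z] too, the value [y b] is
    attained at some [v] in this span, and [b - v] is the corrected vector. *)
Lemma split_off (X : seq V) (Y : seq (V -> R^o)) : [set` X] `<=` W ->
  (forall y, List.In y Y -> functional_mod U y) ->
  exists f b, [/\ functional_mod U f, (forall x, x \in X -> f x = 0), W b, f b = 1 &
    forall y, List.In y Y -> y b = 0].
Proof.
elim: Y X => [|y Y IH] X XW YU.
  by have [f [b [fU fX Wb fb]]] := split_off_functional XW; exists f, b.
have {}IH (Z : seq V) : [set` Z] `<=` W -> exists f b, [/\ functional_mod U f,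
    (forall x, x \in Z -> f x = 0), W b, f b = 1 &
    forall y, List.In y Y -> y b = 0].
  by move=> ZW; apply: IH => // y' Yy'; apply: YU; right.
have [yl yU] : functional_mod U y by apply: YU; left.
pose Q (Z : seq V) := forall z, z \in Z -> W z /\ forall y', List.In y' Y -> y' z = 0.
have syZ (Z : set V) : submodule (y @` lspan Z).
  exact: image_submod (lspan_submod _).
have [||Z QZ Zmax] :=
  @noetherian_max R noethR (seq V) (fun Z => y @` lspan [set` Z]) Q [::].
- by move=> Z _; exact: syZ.
- by [].
have [|f [b [fU fXZ Wb fb Yb]]] := IH (X ++ Z).
  by move=> x; rewrite /= mem_cat => /orP[/XW|/QZ[]].
have : (y @` lspan [set` b :: Z]) `<=` (y @` lspan [set` Z]).
  apply: Zmax.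
    by move=> z; rewrite inE => /predU1P[->|/QZ].
  by apply: image_subset; apply: lspanS => z zZ; rewrite /= inE zZ orbT.
move=> /(_ (y b)) [|v Zv yv].
  by exists b => //; apply: sub_lspan; rewrite /= inE eqxx.
have fv : f v = 0.
  apply: (lspan_min (ker_submod fU.1)) Zv => z zZ /=.
  by apply: fXZ; rewrite mem_cat zZ orbT.
exists f, (b - v); split=> //.
- by move=> x xX; apply: fXZ; rewrite mem_cat xX.
- by apply: (submodB sW) => //; apply: (lspan_min sW) Zv => z /QZ[].
- by rewrite linB ?fb ?fv ?subr0//; exact: fU.1.
- move=> y' [<-|Yy']; first by rewrite linB// yv subrr.
  have [y'l _] : functional_mod U y' by apply: YU; right.
  rewrite linB// Yb// sub0r (_ : y' v = 0) ?oppr0//.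
  by apply: (lspan_min (ker_submod y'l)) Zv => z /QZ[_]; apply.
Qed.

(** Earlier vectors are added to [X] and earlier functionals to [Y], so the pairs come out
    biorthogonal. *)
Lemma split_off_seq (X : seq V) (Y : seq (V -> R^o)) (r : seq I) : uniq r ->
  [set` X] `<=` W -> (forall y, List.In y Y -> functional_mod U y) ->
  exists (b : I -> V) (f : I -> V -> R^o),
    [/\ forall i, functional_mod U (f i) /\ W (b i),
        forall i x, i \in r -> x \in X -> f i x = 0,
        forall i y, i \in r -> List.In y Y -> y (b i) = 0 &
        forall i j, i \in r -> j \in r -> f i (b j) = (i == j)%:R].
Proof.
move=> + XW YU; elim: r => [_|i r IH /= /andP[ir ur]].
  exists (fun=> 0), (fun _ _ => 0); split=> //.
  move=> i; split; last exact: submod0.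
  by split=> // a u v; rewrite scaler0 addr0.
have [b [f [fb fX bY fbE]]] := IH ur.
have [||f0 [b0 [f0U f0X Wb0 f0b0 Yb0]]] :=
  @split_off (X ++ map b r) (Y ++ map f r).
- by move=> x; rewrite /= mem_cat => /orP[/XW//|/mapP[j _ ->]]; exact: (fb j).2.
- by move=> y /In_cat[/YU//|/In_map[j _ ->]]; exact: (fb j).1.
have Yf j : j \in r -> f j b0 = 0.
  by move=> jr; apply: Yb0; apply/In_cat; right; apply/In_map; exists j.
exists (fun j => if j == i then b0 else b j), (fun j => if j == i then f0 else f j).
split.
- by move=> j; case: eqP.
- move=> j x; rewrite inE; case: eqVneq => [_ _ xX|_ /= jr xX]; last exact: fX.
  by apply: f0X; rewrite mem_cat xX.
- move=> j y; rewrite inE; case: eqVneq => [_ _ xX|_ /= jr yY]; last exact: bY.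
  by apply: Yb0; apply/In_cat; left.
- move=> j k; rewrite !inE; case: (eqVneq j i) => [->|ji] /=.
    case: (eqVneq k i) => [->|ki] /= => [_ _|_ kr]; first by rewrite f0b0.
    rewrite f0X//.
    by rewrite mem_cat map_f ?orbT.
  case: (eqVneq k i) => [->|ki] /= jr kr; first by rewrite ?(negbTE ji) Yf.
  exact: fbE.
Qed.

End DualBasis.

(** * Countably generated projective modules *)

Section DualSet.
Variables (R : comNzRingType) (V : lmodType R).
Implicit Types (U Z : set V).

Lemma dual_set_indep U Z : dual_set U Z -> indep U Z.
Proof.
move=> dZ z a Zz; have [f [[fl fU] fz fZ]] := dZ z Zz.
move=> /(_ [set v | f v = 0]) H0.
have /= : [set v | f v = 0] (a *: z).
  apply: H0; last by move=> v [/fU//|[Zv vz]]; exact: fZ.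
  exact: ker_submod.
by rewrite linZ// fz => <-; rewrite /GRing.scale /= mulr1.
Qed.

Lemma dual_set_projection U (Z : seq V) : dual_set U [set` Z] ->
  exists p : V -> V, [/\ linear p, forall u, U u -> p u = u,
    forall z, z \in Z -> p z = 0 & forall v, lspan [set` Z] (v - p v)].
Proof.
move=> dZ.
have /choice[F FP] (z : V) : exists f : V -> R^o, functional_mod U f /\
    (z \in Z -> f z = 1 /\ forall z', z' \in Z -> z' <> z -> f z' = 0).
  have [/dZ[f [fU fz fZ]]|zZ] := boolP (z \in Z); first by exists f.
  by exists (fun=> 0); split=> //; split=> // a u v; rewrite scaler0 addr0.
exists (fun v => v - \sum_(z <- undup Z) F z v *: z); split.
- have Fl : linear (fun v => \sum_(z <- undup Z) F z v *: z).
    by apply: lin_sum_scale => z; exact: (FP z).1.1.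
  by move=> a u v; rewrite Fl scalerBr opprD addrACA.
- move=> u Uu; rewrite big1 ?subr0// => z _.
  by rewrite (FP z).1.2// scale0r.
- move=> z zZ; rewrite (bigD1_seq z) ?mem_undup ?undup_uniq//=.
  rewrite ((FP z).2 zZ).1 scale1r big_seq_cond big1 ?addr0 ?subrr// => y.
  rewrite mem_undup => /andP[yZ yz].
  by rewrite ((FP y).2 yZ).2 ?scale0r//; apply/nesym/eqP.
- move=> v; rewrite opprB addrC subrK.
  apply: (submod_sum (lspan_submod _)) => z; rewrite mem_undup => zZ.
  by apply: (submodZ _ (lspan_submod _)); exact: sub_lspan.
Qed.

Variables (I : eqType) (W : set V) (g : I -> V).
Hypotheses (noethR : noetherian R) (connR : connected_ring R).

(* With [b i], [f i] split off away from the generators [g i] and coordinates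
   [s i] involved in [x], the elements [g i + b i], corrected to be dual to
   [f i + s i], span a free summand containing [x]. *)
Lemma dual_set_catch U (s : I -> V -> R^o) x : dual_basis U W g s ->
  unbounded W s -> W x -> exists Z : seq V,
  [/\ [set` Z] `<=` W, dual_set U [set` Z] & lspan (U `|` [set` Z]) x].
Proof.
move=> db bigW Wx.
have sU := db_submodl db; have sW := db_submodr db.
have Wg := db_gen db.
have sl i : linear (s i) by have [] := db_functional db i.
have sU0 i u : U u -> s i u = 0 by have [_] := db_functional db i; apply.
have [r [ur r0 rU]] := db_expand db Wx.
have [||b [f [fb fg sb fbE]]] :=
    @split_off_seq _ _ _ _ _ _ _ db noethR connR bigW (map g r) (map s r) r ur.
- by move=> _ /mapP[i _ ->].
- by move=> _ /In_map[i _ ->]; exact: db_functional db i.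
have fl i : linear (f i) by have [[]] := fb i.
have fU i u : U u -> f i u = 0 by have [[_ +] _] := fb i; apply.
have Wb i : W (b i) by have [] := fb i.
pose c i := g i + b i - \sum_(l <- r) s l (g i) *: b l.
pose h i : V -> R^o := fun v => f i v + s i v.
have hl i : linear (h i) by exact: lin_add.
have hb i j : i \in r -> j \in r -> h i (b j) = (i == j)%:R.
  by move=> ir jr; rewrite /h fbE// (sb j (s i)) ?addr0//; apply/In_map; exists i.
have hc i j : i \in r -> j \in r -> h i (c j) = (i == j)%:R.
  move=> ir jr; rewrite linB// linD// hb// lin_sum//.
  rewrite (bigD1_seq i)//= linZ// hb// eqxx big_seq_cond big1 ?addr0 => [|l].
    rewrite {1}/h fg ?map_f// add0r /GRing.scale /= mulr1.
    by rewrite addrAC subrr add0r.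
  by move=> /andP[lr li]; rewrite linZ// hb// eq_sym (negbTE li) scaler0.
exists (map c r); split.
- move=> _ /mapP[i _ ->]; apply: (submodB sW); first exact: submodD.
  by apply: (submod_sum sW) => l _; exact: (submodZ _ sW).
- move=> _ /mapP[i ir ->]; exists (h i); split.
  + by split=> // u Uu; rewrite /h fU// sU0// addr0.
  + by rewrite hc// eqxx.
  + move=> _ /mapP[j jr ->] cji; rewrite hc//.
    by case: eqVneq cji => // ->.
(* By this identity the terms in [b] cancel in the combination of the [c i] with coefficients
   [s i x], so it represents [x] modulo [U]. *)
have sx l : s l x = \sum_(i <- r) s i x * s l (g i).
  move: (sU0 l _ rU); rewrite linB// lin_sum// => /eqP; rewrite subr_eq0 => /eqP ->.
  by apply: eq_bigr => i _; rewrite linZ.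
have xc : \sum_(i <- r) s i x *: c i = \sum_(i <- r) s i x *: g i.
  under eq_bigr => i _ do rewrite scalerBr scalerDr scaler_sumr.
  rewrite big_split big_split /= sumrN exchange_big /=.
  rewrite -addrA [X in _ + X](_ : _ = 0) ?addr0//; apply/eqP.
  rewrite subr_eq0; apply/eqP; apply: eq_bigr => l _.
  by rewrite {1}sx scaler_suml; apply: eq_bigr => i _; rewrite scalerA.
rewrite -[x](subrK (\sum_(i <- r) s i x *: c i)).
apply: (submodD (lspan_submod _)); first by apply: sub_lspan; left; rewrite xc.
apply: (submod_sum (lspan_submod _)) => i ir.
by apply: (submodZ _ (lspan_submod _)); apply: sub_lspan; right; exact: map_f.
Qed.

(** The element [x] is caught modulo the span [U'] of [U] and [Z], with coordinates precomposed with
    the projection [p] along [Z]; they stay unbounded since only finitely many are nonzero on [Z].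
    The old functionals become dual to the union after composition with the projection [q] along
    [C]. *)
Lemma dual_set_extend U (s : I -> V -> R^o) (Z : seq V) x : dual_basis U W g s ->
  unbounded W s -> [set` Z] `<=` W -> dual_set U [set` Z] -> W x ->
  exists Z' : seq V, [/\ [set` Z'] `<=` W, dual_set U [set` Z'],
    [set` Z] `<=` [set` Z'] & lspan (U `|` [set` Z']) x].
Proof.
move=> db bigW ZW dZ Wx.
have sU := db_submodl db; have sW := db_submodr db.
have sl i : linear (s i) by have [] := db_functional db i.
have sU0 i u : U u -> s i u = 0 by have [_] := db_functional db i; apply.
have [p [pl pU pZ pE]] := dual_set_projection dZ.
pose U' := lspan (U `|` [set` Z]).
have U'W : U' `<=` W.
  by apply: (lspan_min sW) => v [/(db_sub db)|/ZW].
have pW v : W v -> W (p v).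
  move=> Wv; rewrite -[p v](subKr v); apply: (submodB sW) => //.
  exact: (lspan_min sW ZW) (pE v).
have UU' : U `<=` U' by move=> u Uu; apply: sub_lspan; left.
have ZU' : lspan [set` Z] `<=` U' by apply: lspanS => u; right.
have spl i : linear (s i \o p) by move=> a u v /=; rewrite pl sl.
have db' : dual_basis U' W g (fun i => s i \o p).
  split=> //; [exact: lspan_submod|exact: db_gen db| |].
    move=> i; split=> //; apply: (lspan_min (ker_submod (spl i))).
    move=> v [Uv|Zv] /=; first by rewrite pU// sU0.
    by rewrite pZ// lin0.
  move=> y /pW /(db_expand db)[r [ur r0 rU]]; exists r; split=> //.
  rewrite -[X in X - _](subrK (p y)) -addrA; apply: (submodD (lspan_submod _)).
    by apply: ZU'; exact: pE.
  exact: UU'.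
have bigW' : unbounded W (fun i => s i \o p).
  move=> t; have [r rZ] := coord_finite_seq db ZW.
  have [i [y [it Wy sy]]] := bigW (t ++ r).
  move: it; rewrite mem_cat negb_or => /andP[it ir].
  exists i, y; split=> //= spy; apply: sy.
  rewrite -[X in s i X](subrK (p y)) linD// spy addr0.
  by apply: (lspan_min (ker_submod (sl i))) (pE y) => z; exact: rZ.
have [C [CW dC Cx]] := dual_set_catch db' bigW' Wx.
have [q [ql qU' qC _]] := dual_set_projection dC.
exists (Z ++ C); split.
- by move=> z; rewrite /= mem_cat => /orP[/ZW|/CW].
- move=> z; rewrite /= mem_cat; have [zZ _|zZ /= zC] := boolP (z \in Z).
    have [f [[fl fU] fz fZ]] := dZ z zZ.
    exists (f \o q); split=> /=.
    + by split=> [a u v|u Uu] /=; [rewrite ql fl|rewrite qU' ?fU//; exact: UU'].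
    + by rewrite qU'//; apply: sub_lspan; right.
    + move=> z'; rewrite mem_cat => /orP[z'Z|z'C] zz'; last by rewrite qC// lin0.
      by rewrite qU' ?fZ//; apply: sub_lspan; right.
  have [f [[fl fU'] fz fC]] := dC z zC.
  exists f; split=> //; first by split=> // u /UU'; exact: fU'.
  move=> z'; rewrite mem_cat => /orP[z'Z _|]; last exact: fC.
  by apply: fU'; apply: sub_lspan; right.
- by move=> z zZ; rewrite /= mem_cat zZ.
- apply: lspan_subP Cx => v [|vC]; last first.
    by apply: sub_lspan; right; rewrite /= mem_cat vC orbT.
  by apply: lspanS => y [|yZ]; [left|right; rewrite /= mem_cat yZ].
Qed.

(** The generators are caught one by one by an increasing sequence of finite dual sets. The dual
    functionals change from stage to stage; independence is what passes to the union. *)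
Lemma countable_free U (s : I -> V -> R^o) : dual_basis U W g s ->
  unbounded W s -> countable (range g) ->
  exists Z : set V, [/\ Z `<=` W, indep U Z & W `<=` lspan (U `|` Z)].
Proof.
move=> db bigW.
move=> /pfcard_geP[g0|[e]].
  have [i _] := bigW [::]; have : range g (g i) by exists i.
  by rewrite g0.
have We n : W (e n).
  have [i _ <-] : range g (e n) by exact: funS.
  exact: db_gen db i.
have ge : range g `<=` range e by exact: surj.
pose T := {Z : seq V | [set` Z] `<=` W /\ dual_set U [set` Z]}.
have nxP (q : nat * T) : exists Z' : T, [set` sval q.2] `<=` [set` sval Z'] /\
    lspan (U `|` [set` sval Z']) (e q.1).
  case: q => n [Z [ZW dZ]] /=.
  have [Z' [Z'W dZ' ZZ' Ze]] := dual_set_extend db bigW ZW dZ (We n).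
  by exists (exist _ Z' (conj Z'W dZ')).
have [nx nx1] := choice nxP.
have T0 : [set` [::]] `<=` W /\ dual_set U [set` [::]].
  by split=> [z|z]; rewrite /= in_nil.
pose u := fix u n : T := if n is n'.+1 then nx (n', u n') else exist _ [::] T0.
have umon k l : (k <= l)%N -> [set` sval (u k)] `<=` [set` sval (u l)].
  move=> /subnK <-; elim: (l - k)%N => // j IH x /IH.
  by rewrite addSn /=; apply: (nx1 (_, _)).1.
exists (\bigcup_(n in setT) [set` sval (u n)]); split.
- by move=> z [n _]; exact: (svalP (u n)).1.
- apply: indep_directed => [n _|k l _ _].
    exact: dual_set_indep (svalP (u n)).2.
  exists (maxn k l); split=> //; apply: umon; first by rewrite leq_maxl.
  by rewrite leq_maxr.
move=> x Wx; have [r [_ _ rU]] := db_expand db Wx.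
rewrite -[x](subrK (\sum_(i <- r) s i x *: g i)).
apply: (submodD (lspan_submod _)); first by apply: sub_lspan; left.
apply: (submod_sum (lspan_submod _)) => i _.
apply: (submodZ _ (lspan_submod _)).
have [n _ <-] : range e (g i) by apply: ge; exists i.
apply: lspanS (nx1 (n, u n)).2 => y [|yZ]; [by left|right].
by exists n.+1.
Qed.

End DualSet.

(** * Big projective modules *)

Lemma countable_closure (T : Type) (r : T -> set T) (C0 : set T) :
  (forall i, countable (r i)) -> countable C0 ->
  exists C : set T, [/\ countable C, C0 `<=` C & forall i, C i -> r i `<=` C].
Proof.
move=> rc C0c; pose D n := iter n (fun C => \bigcup_(i in C) r i) C0.
exists (\bigcup_(n in setT) D n); split.
- apply: bigcup_countable => [|n _]; first exact: countableP.
  by elim: n => [//|n IH]; exact: bigcup_countable.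
- by move=> i C0i; exists 0%N.
- by move=> i [n _ Di] j rj; exists n.+1 => //; exists i.
Qed.

Lemma infinite_sequence (T : Type) (S : set T) : infinite_set S ->
  exists f : nat -> T, injective f /\ forall n, S (f n).
Proof.
move=> /infiniteP/pfcard_geP[/seteqP[/(_ 0%N I)//]|[h]].
have /choice[f fP] n : exists i, S i /\ h i = n.
  by have [i Si <-] := surj (f := h) (I : [set: nat] n); exists i.
exists f; split=> [m n fmn|n]; last exact: (fP n).1.
by rewrite -(fP m).2 fmn (fP n).2.
Qed.

Section Kaplansky.
Variables (R : comNzRingType) (V : lmodType R) (I : eqType).
Variables (P : set V) (g : I -> V) (s : I -> V -> R^o).
Hypothesis db : dual_basis [set 0] P g s.
Implicit Types (A B C : set I).

Let sP : submodule P. Proof. exact: db_submodr db. Qed.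
Let sl i : linear (s i). Proof. by have [] := db_functional db i. Qed.

Definition coord_part A : set V := [set x | P x /\ forall i, ~ A i -> s i x = 0].

(** For such [A] the sum of the [s i x *: g i] over [i] in [A] is a projection of [P] onto
    [coord_part A], so closed sets index direct summands of [P]. *)
Definition coord_closed A := forall i, A i -> coord_part A (g i).

(** Extension by zero keeps the index type [I], so a quotient of two closed parts again has a dual
    basis over [I]. *)
Definition coord_cut A B (T : lmodType R) (f : I -> T) i : T :=
  if `[< B i /\ ~ A i >] then f i else 0.

Lemma coord_part_submod A : submodule (coord_part A).
Proof.
apply/submoduleP; split.
  by split=> [|i _]; [exact: submod0 sP|exact: lin0].
move=> a u v [Pu Au] [Pv Av]; split; first exact: submod_lin.
by move=> i Ai; rewrite sl Au// Av// scaler0 addr0.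
Qed.

Lemma coord_partS A B : A `<=` B -> coord_part A `<=` coord_part B.
Proof. by move=> AB x [Px Ax]; split=> // i nBi; apply: Ax => /AB. Qed.

Lemma dual_expand x : P x -> exists r : seq I,
  (forall i, i \notin r -> s i x = 0) /\ x = \sum_(i <- r) s i x *: g i.
Proof.
move=> /(db_expand db)[r [_ r0 xr]]; exists r; split=> //.
by apply/eqP; rewrite -subr_eq0; exact/eqP.
Qed.

Lemma dual_expand_mem (X : set V) x : submodule X -> P x ->
  (forall i, s i x <> 0 -> X (g i)) -> X x.
Proof.
move=> sX Px gX; have [r [_ ->]] := dual_expand Px.
apply: (submod_sum sX) => i _; have [six|/eqP six] := eqVneq (s i x) 0.
  by rewrite six scale0r; exact: submod0.
by apply: (submodZ _ sX); exact: gX.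
Qed.

Lemma supp_finite x : P x -> finite_set [set i | s i x <> 0].
Proof.
move=> /dual_expand[r [r0 _]]; apply: (@sub_finite_set _ _ [set` r]) => // i /= six.
by apply: contrapT => /negP /r0.
Qed.

Lemma coord_closedU A B : coord_closed A -> coord_closed B ->
  coord_closed (A `|` B).
Proof.
move=> cA cB i [/cA|/cB]; apply: coord_partS; [exact: subsetUl|exact: subsetUr].
Qed.

(** In the expansion of an element of [coord_part B], the terms over [A] lie in [coord_part A]
    because [A] is closed, and those outside [B] vanish. *)
Lemma dual_basis_cut A B : coord_closed A -> coord_closed B -> A `<=` B ->
  dual_basis (coord_part A) (coord_part B) (coord_cut A B g)
    (coord_cut A B (s : I -> (V -> R^o))).
Proof.
move=> cA cB AB; split.
- exact: coord_part_submod.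
- exact: coord_part_submod.
- exact: coord_partS.
- move=> i; rewrite /coord_cut; case: asboolP => [[/cB//]|_].
  exact: submod0 (coord_part_submod B).
- move=> i; rewrite /coord_cut; case: asboolP => [[Bi nAi]|_].
    by split=> // u [_]; apply.
  by split=> // a u v; rewrite -[LHS]/0 -[RHS]/(a *: 0 + 0) scaler0 addr0.
- move=> x [Px Bx]; have /(db_expand db)[r [ur r0 xr]] := Px; exists r; split=> //.
    by move=> i /r0 six; rewrite /coord_cut; case: asboolP.
  rewrite -[X in X - _](subrK (\sum_(i <- r) s i x *: g i)) xr add0r -sumrB.
  apply: (submod_sum (coord_part_submod A)) => i _; rewrite /coord_cut.
  case: asboolP => [_|/not_andP[nBi|/contrapT Ai]].
  + by rewrite subrr; exact: submod0 (coord_part_submod A).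
  + by rewrite Bx// scale0r scaler0 subr0; exact: submod0 (coord_part_submod A).
  + rewrite scaler0 subr0; apply: (submodZ _ (coord_part_submod A)).
    exact: cA.
Qed.

Lemma closed_hull C0 (r : I -> set I) : countable C0 -> (forall i, countable (r i)) ->
  exists C, [/\ countable C, C0 `<=` C, coord_closed C & forall i, C i -> r i `<=` C].
Proof.
move=> C0c rc.
have [|C [Cc C0C Cr]] := @countable_closure I
    (fun i => r i `|` [set j | s j (g i) <> 0]) C0 _ C0c.
  move=> i; rewrite -bigcup2E; apply: bigcup_countable; first exact: countableP.
  move=> [|[|n]] _ //=; apply: finite_set_countable; apply: supp_finite.
  exact: db_gen db i.
exists C; split=> // i Ci; last by move=> j rj; apply: (Cr i) => //; left.
split; first exact: db_gen db i.
by move=> j nCj; apply: contrapT => sj; apply: nCj; apply: (Cr i) => //; right.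
Qed.

(** The set [C0] collects the supports of countably many witnesses; once [B] contains it, all of
    them lie in [coord_part B]. *)
Lemma unbounded_cut A : infinite_set [set i | ~ A i /\ exists2 x, P x & s i x <> 0] ->
  exists2 C0, countable C0 & forall B, C0 `<=` B ->
    unbounded (coord_part B) (coord_cut A B (s : I -> (V -> R^o))).
Proof.
move=> /infinite_sequence[f [finj fS]].
have /choice[w wP] n : exists x, P x /\ s (f n) x <> 0.
  by have [_ [x Px sx]] := fS n; exists x.
exists (\bigcup_(n in setT) [set i | s i (w n) <> 0]).
  apply: bigcup_countable => [|n _]; first exact: countableP.
  by apply: finite_set_countable; apply: supp_finite; exact: (wP n).1.
move=> B C0B t.
have [n nt] : exists n, f n \notin t.
  apply: contrapT => H.
  have /uniq_leq_size : uniq (map f (iota 0 (size t).+1)).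
    by rewrite map_inj_uniq ?iota_uniq.
  move=> /(_ t); rewrite size_map size_iota ltnn => fst; suff : false by [].
  by apply: fst => _ /mapP[n _ ->]; apply/negPn/negP => fnt; apply: H; exists n.
have [Pw sw] := wP n.
exists (f n), (w n); split=> //.
  split=> // i nBi; apply: contrapT => si; apply: nBi; apply: C0B.
  by exists n.
rewrite /coord_cut asboolT//; split; last exact: (fS n).1.
by apply: C0B; exists n.
Qed.

Definition partial_basis (p : set I * set V) :=
  [/\ coord_closed p.1, p.2 `<=` coord_part p.1, indep [set 0] p.2 &
      coord_part p.1 `<=` lspan p.2].

(** Zorn's lemma. Bases are compared along with index sets, so that in a chain they are nested and
    their union stays independent. *)
Lemma partial_basis_max : exists2 p, partial_basis p &
  forall q, partial_basis q -> p.1 `<=` q.1 -> p.2 `<=` q.2 -> q.1 `<=` p.1.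
Proof.
pose T := {p | partial_basis p}.
pose le (p q : T) := `[< (sval p).1 `<=` (sval q).1 /\ (sval p).2 `<=` (sval q).2 >].
have [||||[p pb] pmax] := @Zorn T le.
- by move=> p; apply/asboolP; split.
- move=> p q r /asboolP[pq1 pq2] /asboolP[qr1 qr2].
  by apply/asboolP; split; [exact: subset_trans qr1|exact: subset_trans qr2].
- move=> [[A X] pb] [[B Y] qb] /asboolP[/= AB XY] /asboolP[/= BA YX].
  have EA : A = B by apply/seteqP.
  have EX : X = Y by apply/seteqP.
  by rewrite EA EX in pb *; congr (exist _ _ _); exact: Prop_irrelevance.
- move=> D Dtot.
  pose A : set I := \bigcup_(p in D) (sval p).1.
  pose X : set V := \bigcup_(p in D) (sval p).2.
  have pA (p : T) : D p -> (sval p).1 `<=` A by move=> Dp i pi; exists p.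
  have AXb : partial_basis (A, X).
    split=> /=.
    + move=> i [p Dp pi]; apply: coord_partS (pA p Dp) _ _.
      by have [cp _ _ _] := svalP p; exact: cp.
    + move=> x [p Dp px]; apply: coord_partS (pA p Dp) _ _.
      by have [_ Xp _ _] := svalP p; exact: Xp.
    + apply: indep_directed => [p _|p q Dp Dq]; first by have [] := svalP p.
      have [/asboolP[_ pq]|/asboolP[_ qp]] := Dtot p q Dp Dq.
        by exists q; split.
      by exists p; split.
    + move=> x [Px Ax]; apply: (dual_expand_mem (lspan_submod _) Px) => i si.
      have [p Dp pi] : A i by apply: contrapT => /Ax.
      have [cp _ _ Xp] := svalP p.
      by apply: lspanS (Xp _ (cp i pi)) => y py; exists p.
  exists (exist _ _ AXb) => p Dp; apply/asboolP; split=> /=; first exact: pA.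
  by move=> x px; exists p.
exists p => // q qb pq1 pq2.
have := pmax (exist _ q qb) (asboolT (conj pq1 pq2)).
by move=> /(congr1 (fun x => (sval x).1)) /= ->.
Qed.

Hypotheses (noethR : noetherian R) (connR : connected_ring R).

Lemma countable_cut A C : coord_closed A -> coord_closed C -> countable C ->
  unbounded (coord_part (A `|` C)) (coord_cut A (A `|` C) (s : I -> (V -> R^o))) ->
  exists Z, [/\ Z `<=` coord_part (A `|` C), indep (coord_part A) Z &
    coord_part (A `|` C) `<=` lspan (coord_part A `|` Z)].
Proof.
move=> cA cC Cc bigC.
have dbC := dual_basis_cut cA (coord_closedU cA cC) (@subsetUl _ A C).
apply: (countable_free noethR connR dbC bigC).
apply: (@sub_countable _ _ _ ([set 0] `|` g @` C)).
  apply: subset_card_le => _ [i _ <-]; rewrite /coord_cut.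
  by case: asboolP => [[[//|Ci] _]|_]; [right; exists i|left].
rewrite -bigcup2E; apply: bigcup_countable; first exact: countableP.
move=> [|[|n]] _ //=.
exact: sub_countable (card_image_le _ _) Cc.
Qed.

(** If infinitely many coordinates outside [A] were nonzero on [P], a countable closed set would
    enlarge the maximal partial basis; so at most finitely many are left. *)
Lemma big_projective_free : infinite_set [set i | exists2 x, P x & s i x <> 0] ->
  exists X : set V, [/\ X `<=` P, indep [set 0] X & P `<=` lspan X].
Proof.
move=> Pinf.
have [[A X] [/= cA XA iX AX] Amax] := partial_basis_max.
pose S := [set i | ~ A i /\ exists2 x, P x & s i x <> 0].
have [Sfin|Sinf] := pselect (finite_set S); last first.
  have [C0 C0c C0P] := unbounded_cut Sinf.
  have [C [Cc C0C cC _]] := closed_hull C0c (fun=> countable0 _).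
  have C0AC : C0 `<=` A `|` C by move=> i /C0C; right.
  have bigC := C0P _ C0AC.
  have [Z [ZC iZ CZ]] := countable_cut cA cC Cc bigC.
  have [i [x [_ [Px ACx]]]] := bigC [::].
  rewrite /coord_cut; case: asboolP => // -[ACi nAi] six.
  case: nAi; apply: (Amax (A `|` C, X `|` Z)) => //=; [|exact: subsetUl..].
  split=> /=.
  - exact: coord_closedU.
  - move=> y [/XA|/ZC//]; exact/coord_partS/subsetUl.
  - exact: indepU (coord_part_submod A) XA iX iZ.
  - move=> y /CZ; apply: lspan_subP => z [/AX|Zz].
      by apply: lspanS; exact: subsetUl.
    by apply: sub_lspan; right.
have part0 : coord_part set0 = [set 0].
  apply/seteqP; split=> [x [Px x0]|_ ->]; last exact: submod0 (coord_part_submod _).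
  have [r [_ ->]] := dual_expand Px; rewrite big1// => i _.
  by rewrite x0// scale0r.
have c0 : coord_closed set0 by [].
(* Only finitely many coordinates are missed by [A].  They are absorbed in the part
   of a countable closed set [C], compatible with [X], where the countable case
   provides a basis [Z]; together with the rest of [X] it is a basis of [P]. *)
have [|C0 C0c C0P] := @unbounded_cut set0.
  by apply: sub_infinite_set Pinf => i; split.
have /choice[rX rXP] i : exists r : seq V,
    A i -> [set` r] `<=` X /\ lspan [set` r] (g i).
  have [/cA/AX/lspan_finP[r [c [_ rX E]]]|nAi] := pselect (A i); last by exists [::].
  exists r => _; split=> //; rewrite E.
  apply: (submod_sum (lspan_submod _)) => z zr.
  by apply: (submodZ _ (lspan_submod _)); exact: sub_lspan.
(* For [i] in both [A] and [C], the members of [X] that express [g i] will have their supports in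
   [C]. *)
pose rel i := [set j | A i /\ exists2 x, x \in rX i & s j x <> 0].
have [||C [Cc C0C cC Crel]] := @closed_hull (C0 `|` S) rel.
- rewrite -bigcup2E; apply: bigcup_countable; first exact: countableP.
  by move=> [|[|n]] _ //=; exact: finite_set_countable.
- move=> i; have [Ai|nAi] := pselect (A i); last first.
    by apply: (@sub_countable _ _ _ set0) => //; apply: subset_card_le => j [].
  apply: (@sub_countable _ _ _ (\bigcup_(x in [set` rX i]) [set j | s j x <> 0])).
    by apply: subset_card_le => j [_ [x xr sx]]; exists x.
  apply: bigcup_countable => [|x xr]; first exact: finite_set_countable.
  apply: finite_set_countable; apply: supp_finite.
  by have [rXX _] := rXP i Ai; have [] := XA _ (rXX _ xr).
have bigC := C0P (set0 `|` C) (fun i C0i => or_intror (C0C _ (or_introl C0i))).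
have [Z [ZC iZ CZ]] := countable_cut c0 cC Cc bigC.
rewrite set0U part0 in ZC iZ CZ.
have {}CZ : coord_part C `<=` lspan Z.
  move=> x /CZ; apply: lspan_subP => y [->|]; last exact: sub_lspan.
  exact: submod0 (lspan_submod _).
have AC y : coord_part A y -> coord_part C y -> lspan (X `&` coord_part C) y.
  move=> [Py Ay] [_ Cy]; apply: (dual_expand_mem (lspan_submod _) Py) => i si.
  have Ai : A i by apply: contrapT => /Ay.
  have Ci : C i by apply: contrapT => /Cy.
  have [rXX ri] := rXP i Ai; apply: lspanS ri => x xr; split; first exact: rXX.
  split; first by have [] := XA _ (rXX _ xr).
  move=> j nCj; apply: contrapT => sj; apply: nCj; apply: (Crel i Ci).
  by split=> //; exists x.
exists (Z `|` X `\` coord_part C); split.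
- by move=> x [/ZC[]|[/XA[]]].
(* In [a *: z = u + v] the term [u] lies in both parts, so [AC] writes it through members of [X]
   other than [z], and independence of [X] applies. *)
- apply: (indepU (coord_part_submod C)) => // z a [Xz nCz].
  move=> /lspanU[u [v [Cu Xv E]]].
  have {}Cu : coord_part C u by apply: (lspan_min (coord_part_submod C)) Cu.
  have Av : coord_part A v.
    by apply: (lspan_min (coord_part_submod A)) Xv => y [[/XA]].
  have Au : coord_part A u.
    have -> : u = a *: z - v by rewrite E addrK.
    apply: (submodB (coord_part_submod A)) => //.
    by apply: (submodZ _ (coord_part_submod A)); exact: XA.
  apply: (iX z) => //; rewrite E; apply: (submodD (lspan_submod _)).
    apply: lspanS (AC u Au Cu) => y [Xy Cy]; right; split=> // yz.
    by apply: nCz; rewrite -yz.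
  by apply: lspanS Xv => y [[Xy _] yz]; right.
- move=> x Px; apply: (dual_expand_mem (lspan_submod _) Px) => i six.
  have CZ' y : coord_part C y -> lspan (Z `|` X `\` coord_part C) y.
    by move=> /CZ; apply: lspanS; exact: subsetUl.
  have [Ai|nAi] := pselect (A i).
    apply: lspan_subP (AX _ (cA i Ai)) => y Xy.
    have [Cy|nCy] := pselect (coord_part C y); first exact: CZ'.
    by apply: sub_lspan; right.
  apply: CZ'; apply: cC; apply: C0C; right; split=> //.
  by exists x.
Qed.

End Kaplansky.

(** * Slender maps on powers *)

(** Maps built by choice carry linearity as a predicate; this turns them into the bundled maps of
    the definitions. *)
Lemma linear_pack (R : comNzRingType) (V W : lmodType R) (f : V -> W) :
  linear f -> exists g : {linear V -> W}, g = f :> (V -> W).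
Proof.
move=> fl; pose m := GRing.isLinear.Build R V W _ f fl.
by pose g : {linear V -> W} := HB.pack f m; exists g.
Qed.

Lemma ultra_alternative (T : Type) (F : set_system T) : ProperFilter F ->
  (forall A, F A \/ F (~` A)) -> UltraFilter F.
Proof.
move=> FF Falt; split=> // G GF FG; apply/seteqP; split=> // A GA.
have [//|/FG GnA] := Falt A; have : G set0 by rewrite -(setICr A); exact: filterI.
by move/filter_not_empty.
Qed.

(** Without a singleton in [U] the type would be uncountable, since countably many complements of
    points, all in [U], cannot have empty intersection; so [U] would witness [omega_measurable]. *)
Lemma sigma_complete_principal (T : Type) (U : set_system T) :
  ~ omega_measurable T -> UltraFilter U -> sigma_complete U ->
  exists x, U [set x].
Proof.
move=> nmT uU sU; apply: contrapT => /forallNP nU; apply: nmT; split.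
  move=> /pfcard_geP[T0|[e]].
    by have [x _] := filter_ex (filterT : U setT); have : [set: T] x by []; rewrite T0.
  have H n : U (~` [set e n]) by have [/nU|] := in_ultra_setVsetC [set e n] uU.
  have [x Hx] := filter_ex (sU _ H).
  by have [n _ nx] := surj (f := e) (I : [set: T] x); exact: (Hx n I).
exists U; split=> // x Ux; apply: (nU x); rewrite Ux.
exact/principal_filterP.
Qed.

Section SlenderMap.
Variables (R : comNzRingType) (N : lmodType R).

(** Slenderness of a single map rather than of its target: it also covers maps into [L -> N] with
    finitely supported values, where the whole target need not be slender. *)
Definition slender_map (K : Type) (h : power R K -> N) : Prop :=
  forall T : power R nat -> power R K, linear T ->
    finite_set [set n | h (T (unit_vec R n)) <> 0].

Definition slender_module : Prop :=
  forall f : power R nat -> N, linear f -> finite_set [set n | f (unit_vec R n) <> 0].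

Lemma slender_module_map (K : Type) (h : power R K -> N) :
  slender_module -> linear h -> slender_map h.
Proof. by move=> sN hl T Tl; apply: (sN (h \o T)) => a u v /=; rewrite Tl hl. Qed.

Variables (K : Type) (h : power R K -> N).
Hypotheses (hl : linear h) (hs : slender_map h).
Implicit Types (A B : set K) (x : power R K).

Definition supported A x := forall k, ~ A k -> x k = 0.

Definition restrict_to A x : power R K := fun k => if `[< A k >] then x k else 0.

Definition null_set A := forall x, supported A x -> h x = 0.

Lemma restrict_toE A x k : A k -> restrict_to A x k = x k.
Proof. by move=> Ak; rewrite /restrict_to asboolT. Qed.

Lemma restrict_to_supported A x : supported A (restrict_to A x).
Proof. by move=> k nAk; rewrite /restrict_to asboolF. Qed.

Lemma null_setS A B : A `<=` B -> null_set B -> null_set A.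
Proof. by move=> AB nB x Ax; apply: nB => k nBk; apply: Ax => /AB. Qed.

Lemma null_set0 : null_set set0.
Proof.
move=> x x0; rewrite (_ : x = 0) ?lin0//.
by apply/funext => k; exact: x0.
Qed.

(** The formal sum of the [a n *: z n] is finite at each place, hence linear in [a], and it sends
    the unit vectors to the [z n]. *)
Lemma slender_sum (z : nat -> power R K) :
  (forall k, exists m, forall n, (m <= n)%N -> z n k = 0) ->
  finite_set [set n | h (z n) <> 0].
Proof.
move=> /choice[m mP].
pose T (a : power R nat) : power R K := fun k => \sum_(n < m k) a n * z n k.
have Tl : linear T.
  move=> a u v; apply/funext => k.
  rewrite -[RHS]/(a * T u k + T v k) /T mulr_sumr -big_split /=.
  apply: eq_bigr => n _; rewrite -[(a *: u + v) n]/(a * u n + v n); ring.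
apply: sub_finite_set (hs Tl) => n /=.
suff -> : T (unit_vec R n) = z n by [].
apply/funext => k; rewrite /T /unit_vec; have [nm|mn] := ltnP n (m k).
  rewrite (bigD1 (Ordinal nm))//= eqxx mul1r big1 ?addr0// => i.
  by rewrite -val_eqE /= => /negbTE ->; rewrite mul0r.
rewrite mP// big1// => i _; rewrite ltn_eqF ?mul0r//.
exact: leq_trans mn.
Qed.

(* The truncations of [x] off the first [n] sets all have the value [h x], and
   they form a pointwise finite sequence. *)
Lemma null_set_bigcup (A : nat -> set K) :
  (forall n, null_set (A n)) -> null_set (\bigcup_n A n).
Proof.
move=> nA x xA; apply: contrapT => hx.
pose z n := restrict_to (~` \bigcup_(i in `I_n) A i) x.
have hz n : h (z n) = h x.
  elim: n => [|n <-].
    by congr h; apply/funext => k; rewrite /z restrict_toE// => -[].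
  apply/eqP; rewrite -subr_eq0 -(linB _ _ hl); apply/eqP.
  apply: (nA n) => k nAk; rewrite -[LHS]/(z n.+1 k - z n k).
  apply/eqP; rewrite subr_eq0; apply/eqP; rewrite /z /restrict_to.
  congr (if _ then _ else _); apply/asboolP/asboolP.
    move=> Ank [i /= ni Aik]; apply: Ank; exists i => //=; exact: ltnW.
  move=> Ank [i /=]; rewrite ltnS leq_eqVlt => /predU1P[->//|ni Aik].
  by apply: Ank; exists i.
have /slender_sum : forall k, exists m, forall n, (m <= n)%N -> z n k = 0.
  move=> k; have [[i _ Aik]|nAk] := pselect ((\bigcup_n A n) k).
    exists i.+1 => n ni; rewrite /z /restrict_to asboolF//; apply.
    by exists i.
  by exists 0%N => n _; rewrite /z /restrict_to xA//; case: asboolP.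
rewrite (_ : [set _ | _] = setT); first exact: infinite_nat.
by apply/seteqP; split=> // n _ /=; rewrite hz.
Qed.

Lemma null_setU A B : null_set A -> null_set B -> null_set (A `|` B).
Proof.
move=> nA nB; rewrite -bigcup2E; apply: null_set_bigcup => -[|[|n]] //=.
exact: null_set0.
Qed.

Lemma null_set_ultra A : ~ null_set A ->
  (forall B, null_set (A `&` B) \/ null_set (A `\` B)) ->
  UltraFilter [set B | null_set (A `\` B)] /\ sigma_complete [set B | null_set (A `\` B)].
Proof.
move=> nnA atomA; split; last first.
  move=> F FA; rewrite /= setDE setC_bigcap setI_bigcupr.
  by apply: null_set_bigcup => n; rewrite -setDE; exact: FA.
apply: ultra_alternative; last first.
  by move=> B; have [|] := atomA B; [right; rewrite /= setDE setCK|left].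
split; first by rewrite /= setD0.
split=> /=; first by rewrite setDT; exact: null_set0.
- by move=> B C nB nC; rewrite /= setDIr; exact: null_setU.
- by move=> B C BC; apply: null_setS; exact: setDS.
Qed.

(** The decomposition into null sets and atoms as an induction principle. A set failing [F] is
    neither, so it splits into two sets that are not null, one of them failing [F]. Iterating leaves
    disjoint non-null differences, and vectors supported there contradict [slender_sum]. *)
Lemma slender_map_ind (F : set K -> Prop) :
  (forall A, null_set A -> F A) ->
  (forall A U, UltraFilter U -> sigma_complete U ->
     (forall B, U B -> null_set (A `\` B)) -> F A) ->
  (forall A B, F A -> F B -> F (A `|` B)) -> F setT.
Proof.
move=> Fnull Fultra FU; apply: contrapT => nFT.
pose T := {A | ~ F A}.
have nxP (A : T) : exists B : T,
    sval B `<=` sval A /\ ~ null_set (sval A `\` sval B).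
  case: A => A nFA /=.
  have [B nnB] : exists B, ~ null_set (A `&` B) /\ ~ null_set (A `\` B).
    apply: contrapT => /forallNP atomA.
    have nnA : ~ null_set A by move=> nA; apply: nFA; exact: Fnull.
    have [|uU sU] := null_set_ultra nnA.
      by move=> B; have /not_andP[/contrapT|/contrapT] := atomA B; [left|right].
    by apply: nFA; apply: (Fultra A _ uU sU).
  have : ~ F (A `&` B) \/ ~ F (A `\` B).
    apply/not_andP => -[FAB FA'B]; apply: nFA.
    by rewrite -[A](setUIDK _ B); exact: FU.
  case=> [nF|nF].
    exists (exist (fun B => ~ F B) _ nF) => /=; split; first exact: subIsetl.
    by rewrite setDIr setDv set0U; exact: nnB.2.
  exists (exist (fun B => ~ F B) _ nF) => /=; split; first exact: subDsetl.
  by rewrite setDD; exact: nnB.1.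
have [nx nx1] := choice nxP.
pose u n := sval (iter n nx (exist (fun B => ~ F B) setT nFT)).
have umon m n : (m <= n)%N -> u n `<=` u m.
  move=> /subnK <-; elim: (n - m)%N => // j IH; apply: subset_trans IH.
  by rewrite addSn /u /=; exact: (nx1 _).1.
have /choice[z zP] n : exists x, supported (u n `\` u n.+1) x /\ h x <> 0.
  have := (nx1 (iter n nx (exist (fun B => ~ F B) setT nFT))).2.
  by move=> /existsNP[x /not_implyP[? ?]]; exists x.
have /slender_sum : forall k, exists m, forall n, (m <= n)%N -> z n k = 0.
  move=> k; have [[m zk]|/forallNP z0] := pselect (exists m, z m k <> 0); last first.
    by exists 0%N => n _; apply: contrapT; exact: z0.
  exists m.+1 => n mn; apply: (zP n).1 => -[unk _]; apply: zk.
  by apply: (zP m).1 => -[_]; apply; exact: umon unk.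
rewrite (_ : [set _ | _] = setT); first exact: infinite_nat.
by apply/seteqP; split=> // n _ /=; exact: (zP n).2.
Qed.

(** The image of [U] under [x] is a countably complete ultrafilter on [R], hence principal, so [x]
    is constant on [A] up to a null set. *)
Lemma ultra_constant A (U : set_system K) x : ~ omega_measurable R ->
  UltraFilter U -> sigma_complete U -> (forall B, U B -> null_set (A `\` B)) ->
  supported A x -> exists c, h x = c *: h (restrict_to A (fun=> 1)).
Proof.
move=> nmR uU sU UA Ax.
have uxU : UltraFilter (fmap x U).
  apply: ultra_alternative => B.
  by have [|] := in_ultra_setVsetC (x @^-1` B) uU; [left|right].
have [c Uc] : exists c, fmap x U [set c].
  by apply: sigma_complete_principal => // F FU; exact: (sU _ FU).
exists c; apply/eqP; rewrite -subr_eq0 -(linZ _ _ hl) -(linB _ _ hl); apply/eqP.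
apply: (UA _ Uc) => k nAk.
rewrite -[LHS]/(x k - c * restrict_to A (fun=> 1) k).
have [Ak|nAk'] := pselect (A k).
  rewrite restrict_toE// mulr1; apply/eqP; rewrite subr_eq0; apply/eqP.
  by apply: contrapT => xk; exact: nAk.
by rewrite Ax// restrict_to_supported// mulr0 subr0.
Qed.

End SlenderMap.

(** The ultrafilter of an atom is now principal, so on that atom [h] depends on one coordinate. *)
Lemma slender_map_finite (R : comNzRingType) (N : lmodType R) (K : eqType)
    (h : power R K -> N) : linear h -> slender_map h -> ~ omega_measurable K ->
  exists r : seq K, forall x, (forall k, k \in r -> x k = 0) -> h x = 0.
Proof.
move=> hl hs nmK.
pose F A := exists r : seq K, forall x : power R K, supported A x ->
  (forall k, k \in r -> x k = 0) -> h x = 0.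
have [|||r rP] := @slender_map_ind _ _ _ _ hl hs F.
- by move=> A nA; exists [::] => x Ax _; exact: nA.
- move=> A U uU sU UA; have [k Uk] := sigma_complete_principal nmK uU sU.
  exists [:: k] => x Ax xk; apply: (UA _ Uk) => j nAj.
  have [->|jk] := eqVneq j k; first by apply: xk; rewrite inE.
  by apply: Ax => Aj; apply: nAj; split=> //; exact/eqP.
- move=> A B [r rA] [r' rB]; exists (r ++ r') => x ABx xr.
  have -> : x = restrict_to A x + (x - restrict_to A x) by rewrite addrC subrK.
  rewrite (linD _ _ hl) rA ?rB ?addr0//.
  + move=> k nBk; rewrite -[LHS]/(x k - restrict_to A x k) /restrict_to.
    case: asboolP => [_|nAk]; first by rewrite subrr.
    by rewrite ABx ?subr0// => -[].
  + move=> k kr'; rewrite -[LHS]/(x k - restrict_to A x k) /restrict_to xr ?if_same ?subr0//.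
    by rewrite mem_cat kr' orbT.
  + exact: restrict_to_supported.
  + by move=> k kr; rewrite /restrict_to xr ?if_same// mem_cat kr.
by exists r => x xr; apply: rP => // k [].
Qed.

(** * Maps whose values have finite support *)

Section GlidingHump.
Variables (R : comNzRingType) (N : lmodType R) (K : Type) (L : Type).
Variable h : power R K -> (L -> N).
Hypotheses (hl : linear h) (sN : slender_module N).
Hypothesis hfin : forall x, finite_set [set l | h x l <> 0].

(* Gliding hump: otherwise pick unit vectors whose images [f l (unit_vec R (n k))]
   have pairwise disjoint nonempty supports; their formal sum [y] would have an
   image of infinite support. *)
Lemma slender_map_fun : slender_map h.
Proof.
move=> T Tl; apply: contrapT => Tinf.
pose f l : power R nat -> N := fun a => h (T a) l.
have fl l : linear (f l) by move=> a u v; rewrite /f Tl hl.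
(* Finite for finite [D], as [N] is slender; avoiding it makes the next support disjoint from
   [D]. *)
pose bad D := [set n | exists2 l, D l & f l (unit_vec R n) <> 0].
have nP (D : {D : set L | finite_set D}) :
    exists n, h (T (unit_vec R n)) <> 0 /\ ~ bad (sval D) n.
  case: D => D Dfin /=.
  have : infinite_set ([set n | h (T (unit_vec R n)) <> 0] `\` bad D).
    apply: infinite_setD => //.
    apply: sub_finite_set (bigcup_finite Dfin (fun l _ => sN (fl l))) => n [l Dl fln].
    by exists l.
  by move=> /infinite_setN0[n [? ?]]; exists n.
have [nn nnP] := choice nP.
pose supp n := [set l | h (T (unit_vec R n)) l <> 0].
have nxP (D : {D : set L | finite_set D}) : finite_set (sval D `|` supp (nn D)).
  by rewrite finite_setU; split; [exact: (svalP D)|exact: hfin].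
pose D k := iter k (fun D => exist _ _ (nxP D)) (exist _ set0 (finite_set0 L)).
pose n k := nn (D k).
have Dmon i j : (i <= j)%N -> sval (D i) `<=` sval (D j).
  move=> /subnK <-; elim: (j - i)%N => // m IH x /IH.
  by rewrite addSn /=; left.
have /choice[l lP] k : exists l, f l (unit_vec R (n k)) <> 0.
  apply: contrapT => /forallNP f0; apply: (nnP (D k)).1.
  by apply/funext => l; apply: contrapT; exact: f0.
have lD k : sval (D k.+1) (l k) by right; exact: lP.
have lnD k : ~ sval (D k) (l k).
  by move=> Dl; apply: (nnP (D k)).2; exists (l k).
have fnl j k : j <> k -> f (l k) (unit_vec R (n j)) = 0.
  move=> jk; apply: contrapT => fjk.
  have [jk'|kj|//] := ltngtP j k.
    by apply: (lnD k); apply: (Dmon j.+1 k) => //; right.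
  by apply: (nnP (D j)).2; exists (l k) => //; apply: Dmon (lD k).
pose y : power R nat := fun m => (`[< exists k, m = n k >])%:R.
have fy k : f (l k) y <> 0.
  have -> : y = unit_vec R (n k) + (y - unit_vec R (n k)) by rewrite addrC subrK.
  rewrite (linD _ _ (fl _)) (_ : f _ (y - _) = 0) ?addr0//.
  have fs := slender_module_map sN (fl (l k)).
  (* Each other point [n j] is null for [f (l k)], hence so is their union: only [unit_vec R (n k)]
     contributes to the value at [y]. The place [j = k] is filled with the empty set. *)
  have nullA j : null_set (f (l k)) (if j == k then set0 else [set n j]).
    case: eqVneq => [_|/eqP jk]; first exact: null_set0.
    move=> x xj; rewrite (_ : x = x (n j) *: unit_vec R (n j)).
      by rewrite (linZ _ _ (fl _)) fnl// scaler0.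
    apply/funext => i; rewrite -[RHS]/(x (n j) * (i == n j)%:R).
    have [->|/eqP ij] := eqVneq i (n j); first by rewrite mulr1.
    by rewrite mulr0 xj.
  apply: (null_set_bigcup (fl _) fs nullA) => i nAi.
  rewrite -[LHS]/(y i - (i == n k)%:R) /y.
  have [->|/eqP ik] := eqVneq i (n k).
    by rewrite asboolT ?subrr//; exists k.
  rewrite subr0 asboolF// => -[j ij]; apply: nAi; exists j => //.
  by case: eqVneq => // jk; apply: ik; rewrite ij jk.
have linj : injective l.
  move=> i j lij; apply: contrapT => ij.
  by apply: (lP i); rewrite lij; exact: fnl.
have := finite_preimage (f := l) (fun i j _ _ => @linj i j) (hfin (T y)).
rewrite (_ : _ @^-1` _ = setT); first exact: infinite_nat.
by apply/seteqP; split=> // k _; exact: fy.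
Qed.

(** On an atom every value of [h] is a multiple of its value at the indicator of [A], which has
    finite support. *)
Lemma finite_support_range : ~ omega_measurable R ->
  finite_set [set l | exists x, h x l <> 0].
Proof.
move=> nmR.
pose F A := finite_set [set l | exists x, supported A x /\ h x l <> 0].
have FT : F setT.
  apply: (slender_map_ind hl slender_map_fun).
  - move=> A nA; rewrite /F (_ : [set _ | _] = set0)//; apply/seteqP; split=> // l.
    by move=> [x [/nA -> []]].
  - move=> A U uU sU UA; apply: sub_finite_set (hfin (restrict_to A (fun=> 1))).
    move=> l [x [Ax hx]] h1; apply: hx.
    have [c ->] := ultra_constant hl nmR uU sU UA Ax.
    by rewrite -[LHS]/(c *: _ l) h1 scaler0.
  - move=> A B FA FB; rewrite /F.
    apply: (@sub_finite_set _ _ ([set l | exists x, supported A x /\ h x l <> 0] `|`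
      [set l | exists x, supported B x /\ h x l <> 0])); last by rewrite finite_setU.
    move=> l [x [ABx hx]]; apply: contrapT => /not_orP[/forallNP nA /forallNP nB].
    apply: hx; have -> : x = restrict_to A x + (x - restrict_to A x) by rewrite addrC subrK.
    rewrite (linD _ _ hl) -[LHS]/(h _ l + h _ l).
    have /not_andP[[]|/contrapT ->] := nA (restrict_to A x).
      exact: restrict_to_supported.
    have /not_andP[[]|/contrapT ->] := nB (x - restrict_to A x); last by rewrite addr0.
    move=> k nBk; rewrite -[LHS]/(x k - restrict_to A x k) /restrict_to.
    case: asboolP => [_|nAk]; first by rewrite subrr.
    by rewrite ABx ?subr0// => -[].
by apply: sub_finite_set FT => l [x hx]; exists x; split=> // k [].
Qed.

End GlidingHump.

(** * Direct summands of powers *)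

Lemma slender_module_regular (R : comNzRingType) :
  slender R -> slender_module (R^o : lmodType R).
Proof. by move=> sR f /linear_pack[g <-]; exact: sR. Qed.

Section FinitelyPresented.
Variables (R S : comNzRingType) (phi : {rmorphism R -> S}).
Local Notation N := (restr_scalars phi : lmodType R).

(* As [S] is finitely presented, [S^omega] is [S] tensor [R^omega], so an
   [R]-linear map on [R^omega] extends to an [S]-linear one on [S^omega]. *)
Lemma fin_presented_slender_module :
  slender S -> fin_presented N -> slender_module N.
Proof.
move=> sS [n [p [psurj [m [g pker]]]]] f fl.
pose t i : S := p (delta_mx 0 i).
have pE (u : 'rV[R]_n) : p u = \sum_i phi (u 0 i) * t i :> S.
  rewrite {1}[u]row_sum_delta linear_sum; apply: eq_bigr => i _.
  by rewrite linearZ.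
have scaleE a (x : N) : a *: x = phi a * (x : S) :> S by [].
(* Here [u] is a lift along [p] of a sequence in [S], and [F0] is the extended map in terms of
   lifts. It is independent of the lift because the kernel of [p] is finitely generated. *)
pose F0 (u : nat -> 'rV[R]_n) : S := \sum_i t i * (f (fun k => u k 0 i) : S).
have F0ker u : (forall k, p (u k) = 0) -> F0 u = 0.
  move=> pu0.
  have /choice[c cE] k : exists c : 'I_m -> R, \sum_(j < m) c j *: g j = u k.
    have : [set x | p x = 0] (u k) by exact: pu0.
    by rewrite pker => -[c _ <-]; exists c.
  have pg j : p (g j) = 0.
    have : [set x | p x = 0] (g j); last by [].
    rewrite pker; exists (fun i => (i == j)%:R) => //.
    rewrite (bigD1 j)//= eqxx scale1r big1 ?addr0// => i /negbTE ->.
    by rewrite scale0r.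
  have fE i : f (fun k => u k 0 i) = \sum_(j < m) g j 0 i *: f (fun k => c k j).
    rewrite (_ : (fun k => u k 0 i) =
        \sum_(j < m) g j 0 i *: ((fun k => c k j) : power R nat)).
      by rewrite lin_sum//; apply: eq_bigr => j _; rewrite linZ.
    apply/funext => k; rewrite -cE summxE fct_sumE; apply: eq_bigr => j _.
    by rewrite mxE mulrC.
  rewrite /F0; under eq_bigr => i _ do rewrite fE mulr_sumr.
  rewrite exchange_big big1//= => j _.
  transitivity ((p (g j) : S) * (f (fun k => c k j) : S)); last first.
    by rewrite pg; exact: mul0r.
  rewrite pE mulr_suml.
  by apply: eq_bigr => i _; rewrite scaleE; ring.
have F0l (a : R) u v : F0 (fun k => a *: u k + v k) = phi a * F0 u + F0 v.
  rewrite /F0 mulr_sumr -big_split; apply: eq_bigr => i _ /=.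
  rewrite (_ : (fun k => (a *: u k + v k) 0 i) =
    a *: ((fun k => u k 0 i) : power R nat) + ((fun k => v k 0 i) : power R nat)).
    by rewrite fl mulrDr scaleE mulrCA.
  by apply/funext => k; rewrite !mxE.
have F0eq u v : (forall k, p (u k) = p (v k)) -> F0 u = F0 v.
  move=> puv; apply/eqP; rewrite -subr_eq0; apply/eqP.
  have := F0l (-1) v u; rewrite rmorphN rmorph1 mulN1r addrC => <-.
  by apply: F0ker => k; rewrite linearP puv scaleN1r addNr.
have /choice[q qP] (x : N) : exists u, p u = x.
  have : [set: N] x by [].
  by rewrite -psurj => -[u _ <-]; exists u.
(* A lift of multiplication by [s] to row vectors, for the [S]-linearity of [F]. *)
pose smul s (u : 'rV[R]_n) : 'rV[R]_n := \sum_i u 0 i *: q (s * t i : S).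
have psmul s u : p (smul s u) = s * (p u : S) :> S.
  rewrite /smul linear_sum pE mulr_sumr; apply: eq_bigr => i _.
  by rewrite linearZ /= scaleE qP; ring.
have F0smul s u : F0 (fun k => smul s (u k)) = s * F0 u.
  have E i : f (fun k => smul s (u k) 0 i) =
      \sum_j q (s * t j : S) 0 i *: f (fun k => u k 0 j).
    rewrite (_ : (fun k => smul s (u k) 0 i) =
        \sum_j q (s * t j : S) 0 i *: ((fun k => u k 0 j) : power R nat)).
      by rewrite lin_sum//; apply: eq_bigr => j _; rewrite linZ.
    apply/funext => k; rewrite summxE fct_sumE; apply: eq_bigr => j _.
    by rewrite mxE mulrC.
  rewrite /F0; under eq_bigr => i _ do rewrite E mulr_sumr.
  rewrite exchange_big mulr_sumr; apply: eq_bigr => j _ /=.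
  transitivity ((p (q (s * t j : S)) : S) * (f (fun k => u k 0 j) : S)); last first.
    by rewrite qP mulrA.
  rewrite pE mulr_suml; apply: eq_bigr => i _.
  by rewrite scaleE; ring.
pose F (y : power S nat) : S^o := F0 (fun k => q (y k)).
have Fl : linear F.
  move=> a y z; rewrite -[RHS]/(a * F y + F z) /F -F0smul.
  have := F0l 1 (fun k => smul a (q (y k))) (fun k => q (z k)).
  rewrite rmorph1 mul1r => <-; apply: F0eq => k.
  by rewrite scale1r linearD psmul !qP.
have [G GF] := linear_pack Fl.
have := sS G; rewrite GF; apply: sub_finite_set => i /= fi Fi; apply: fi.
(* With this lift of 1, the extension is seen to take at a unit vector over [S] the value of [f] at
   the one over [R]. *)
pose w := q (1 : S).
transitivity (F0 (fun k => (k == i)%:R *: w)); last first.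
  rewrite -[RHS]Fi; apply: F0eq => k.
  by rewrite qP linearZ /= scaleE qP /unit_vec rmorph_nat mulr1.
transitivity ((p w : S) * (f (unit_vec R i) : S)); first by rewrite qP mul1r.
rewrite pE mulr_suml; apply: eq_bigr => j _.
rewrite (_ : (fun k => _) = w 0 j *: unit_vec R i).
  by rewrite linZ// scaleE; ring.
by apply/funext => k; rewrite !mxE mulrC.
Qed.

End FinitelyPresented.

Lemma summand_retraction (R : comNzRingType) (W V : lmodType R) :
  iso_to_direct_summand W V ->
  exists (f : W -> V) (p : V -> W), [/\ linear f, linear p & cancel f p].
Proof.
move=> [A [[sA [B [sB AB0 ABT]]] [f [finj fA]]]].
have fl : linear f by exact: linearP.
have dec v : exists w, B (v - f w).
  have : [set: V] v by []; rewrite -ABT => -[a Aa [b Bb <-]].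
  by move: Aa; rewrite -fA => -[w _ <-]; exists w; rewrite addrC addKr.
have uni w : B (f w) -> w = 0.
  move=> Bfw; apply: finj; rewrite linear0.
  have : (A `&` B) (f w) by split=> //; rewrite -fA; exists w.
  by rewrite AB0.
have [p pB] := choice dec.
exists f, p; split=> //; last first.
  move=> w; apply/eqP; rewrite eq_sym -subr_eq0; apply/eqP; apply: uni.
  by rewrite linearB; exact: pB.
move=> a u v; apply/eqP; rewrite eq_sym -subr_eq0; apply/eqP; apply: uni.
rewrite linearB linearP.
have -> : a *: f (p u) + f (p v) - f (p (a *: u + v)) =
    (a *: u + v - f (p (a *: u + v))) - (a *: (u - f (p u)) + (v - f (p v))).
  by rewrite scalerBr [X in _ = _ - X]addrACA -opprD opprB [RHS]addrC [RHS]addrA subrK.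
by apply: (submodB sB (pB _)); apply: (submod_lin _ sB).
Qed.

Section DirectSumSummand.
Variables (R : comNzRingType) (K L : Type).

Lemma direct_sum_summand_finite : ~ omega_measurable R -> w_slender R ->
  iso_to_direct_summand (direct_sum R L) (power R K) -> finite_set [set: L].
Proof.
move=> nmR [S [phi [sS fpS]]] /summand_retraction[f [p [fl pl fpK]]].
have sN := fin_presented_slender_module sS fpS.
pose h (x : power R K) : L -> (restr_scalars phi : lmodType R) :=
  fun l => phi ((p x : power R L) l).
have hl : linear h.
  move=> a u v; apply/funext => l; rewrite /h pl.
  rewrite -[LHS]/(phi (a * (p u : power R L) l + (p v : power R L) l)).
  by rewrite rmorphD rmorphM.
have hfin x : finite_set [set l | h x l <> 0].
  have /asboolP := valP (p x); apply: sub_finite_set => l /= hx px; apply: hx.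
  by rewrite /h px rmorph0.
apply: sub_finite_set (finite_support_range hl sN hfin nmR) => l _ /=.
pose e : power R L := fun l' => (`[< l' = l >])%:R.
have efin : e \in @finsupp R L.
  apply/asboolP; apply: (@sub_finite_set _ _ [set l]) => // l' /=.
  by rewrite /e; case: asboolP.
exists (f (DirectSum efin)); rewrite /h fpK /= /e asboolT// rmorph1.
exact/eqP/oner_neq0.
Qed.

End DirectSumSummand.

(** The extension is given by its graph [G], the span of the pairs [(z, c z)]; independence makes it
    single-valued. Outside the span of [X] the values are arbitrary. *)
Lemma indep_extend (R : comNzRingType) (V : lmodType R) (X : set V) (c : V -> R^o) :
  indep [set 0] X -> exists f : V -> R^o,
  (forall a u v, lspan X u -> lspan X v -> f (a *: u + v) = a *: f u + f v) /\
  forall z, X z -> f z = c z.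
Proof.
move=> iX.
pose G : set (V * R^o)%type := lspan [set y | exists2 z, X z & y = (z, c z)].
have sG : submodule G by exact: lspan_submod.
have Gex u : lspan X u -> exists b, G (u, b).
  move=> Xu; pattern u; refine (Xu _ _ _) => {u Xu}.
    apply/submoduleP; split; first by exists 0; exact: submod0 sG.
    move=> a u v [b Gb] [b' Gb']; exists (a *: b + b').
    exact: (submod_lin a sG Gb Gb').
  by move=> z Xz; exists (c z); apply: sub_lspan; exists z.
have G0 b : G (0, b) -> b = 0.
  move=> /lspan_finP[r [d [ur rG E]]].
  have rE y : y \in r -> X y.1 /\ y.2 = c y.1 by move=> /rG[z Xz ->].
  have inj1 : {in r &, injective (@fst V R^o)}.
    by move=> [y1 y2] [z1 z2] /rE[/= _ ->] /rE[/= _ ->] ->.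
  have uz : uniq (map fst r) by rewrite map_inj_in_uniq.
  have lin1 : linear (fst : V * R^o -> V) by [].
  have lin2 : linear (snd : V * R^o -> R^o) by [].
  pose d' (z : V) := d (z, c z).
  have dE y : y \in r -> d y = d' y.1.
    by move=> /rE[_]; case: y => y1 y2 /= ->.
  have s0 : \sum_(z <- map fst r) d' z *: z = 0.
    rewrite big_map; transitivity ((0, b) : V * R^o).1 => //.
    rewrite E (lin_sum _ _ lin1) big_seq [RHS]big_seq; apply: eq_bigr => y yr.
    by rewrite (linZ _ _ lin1) dE.
  have d0 z : z \in map fst r -> d' z = 0.
    apply: (indep_sum _ iX uz _ s0).
      apply/submoduleP; split=> // a u v -> ->; by rewrite scaler0 addr0.
    by move=> _ /mapP[y yr ->]; exact: (rE y yr).1.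
  transitivity ((0, b) : V * R^o).2 => //.
  rewrite E (lin_sum _ _ lin2) big_seq big1// => y yr.
  by rewrite (linZ _ _ lin2) dE// d0 ?scale0r// map_f.
have Guni u b b' : G (u, b) -> G (u, b') -> b = b'.
  move=> Gb Gb'; apply/eqP; rewrite -subr_eq0; apply/eqP; apply: G0.
  by have := submodB sG Gb Gb'; rewrite -[(u, b) - _]/(u - u, b - b') subrr.
have /choice[f fP] u : exists b, lspan X u -> G (u, b).
  by have [/Gex[b]|nX] := pselect (lspan X u); [exists b|exists 0].
exists f; split=> [a u v Xu Xv|z Xz]; last first.
  apply: Guni (fP z (sub_lspan Xz)) _.
  by apply: sub_lspan; exists z.
apply: Guni (fP _ (submod_lin a (lspan_submod _) Xu Xv)) _.
exact: (submod_lin a sG (fP u Xu) (fP v Xv)).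
Qed.

(** * Pairing finitely supported vectors with arbitrary ones *)

Section DotProduct.
Variables (R : comNzRingType) (K : choiceType).
Implicit Types (x y : power R K) (a : R).

Definition fin_supp x := finite_set [set k | x k <> 0].

Definition std_vec (j : K) : power R K := fun k => (k == j)%:R.

(** A sum with infinitely many nonzero terms defaults to 0, so bilinearity is stated for finitely
    supported left arguments. *)
Definition dotp x y : R := \sum_(k \in [set: K]) x k * y k.

Lemma dotpE x y (r : seq K) : uniq r -> (forall k, k \notin r -> x k = 0) ->
  dotp x y = \sum_(k <- r) x k * y k.
Proof.
move=> ur xr; rewrite /dotp (fsbigE r)//; last first.
  by move=> k _ /xr ->; rewrite mul0r.
by apply: eq_bigl => k; rewrite in_setT.
Qed.

Lemma fin_suppP x : fin_supp x ->
  exists r : seq K, uniq r /\ forall k, k \notin r -> x k = 0.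
Proof.
move=> /finite_seqP[r xr]; exists (undup r); split; first exact: undup_uniq.
move=> k; rewrite mem_undup => kr; apply: contrapT => xk.
have : [set k | x k <> 0] k by [].
by rewrite xr /= (negbTE kr).
Qed.

Lemma seq_fin_supp x (r : seq K) : (forall k, k \notin r -> x k = 0) -> fin_supp x.
Proof.
move=> xr; apply: (@sub_finite_set _ _ [set` r]) => // k /= xk.
by apply: contrapT => /negP/xr.
Qed.

Lemma fin_supp_submod : submodule fin_supp.
Proof.
apply/submoduleP; split.
  by apply: (@seq_fin_supp _ [::]) => k _.
move=> a x y /fin_suppP[r [_ xr]] /fin_suppP[r' [_ yr']].
apply: (@seq_fin_supp _ (r ++ r')) => k; rewrite mem_cat negb_or => /andP[kr kr'].
by rewrite -[LHS]/(a * x k + y k) xr// yr'// mulr0 addr0.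
Qed.

Lemma dotp_linearl y a x x' : fin_supp x -> fin_supp x' ->
  dotp (a *: x + x') y = a * dotp x y + dotp x' y.
Proof.
move=> /fin_suppP[r [_ xr]] /fin_suppP[r' [_ xr']].
have ut : uniq (undup (r ++ r')) by exact: undup_uniq.
have H k : k \notin undup (r ++ r') -> x k = 0 /\ x' k = 0.
  by rewrite mem_undup mem_cat negb_or => /andP[/xr ? /xr' ?].
rewrite !(dotpE _ ut); [|by move=> k /H[]|by move=> k /H[]|]; last first.
  by move=> k /H[x0 x'0]; rewrite -[LHS]/(a * x k + x' k) x0 x'0 mulr0 addr0.
rewrite mulr_sumr -big_split; apply: eq_bigr => k _ /=.
by rewrite -[(a *: x + x') k]/(a * x k + x' k); ring.
Qed.

Lemma dotp_linearr x : fin_supp x -> linear (dotp x : power R K -> R^o).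
Proof.
move=> /fin_suppP[r [ur xr]] a u v.
rewrite !(dotpE _ ur xr) scaler_sumr -big_split; apply: eq_bigr => k _ /=.
by rewrite -[(a *: u + v) k]/(a * u k + v k) /GRing.scale /=; ring.
Qed.

Lemma dotp0l y : dotp 0 y = 0.
Proof. by rewrite (@dotpE 0 y [::]) ?big_nil. Qed.

Lemma dotp_std_vec x j : dotp x (std_vec j) = x j.
Proof.
rewrite /dotp (fsbigE [:: j])//; last first.
  by move=> k _; rewrite inE /std_vec => /negbTE ->; rewrite mulr0.
by rewrite big_mkcond big_seq1 in_setT /std_vec eqxx mulr1.
Qed.

Lemma sum_std_vec y (r : seq K) k : uniq r ->
  (\sum_(j <- r) y j *: std_vec j) k = if k \in r then y k else 0.
Proof.
move=> ur; rewrite fct_sumE; have [kr|kr] := boolP (k \in r).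
  rewrite (bigD1_seq k)//= -[X in X + _]/(y k * (k == k)%:R) eqxx mulr1.
  rewrite big1 ?addr0// => j /negbTE jk.
  by rewrite -[LHS]/(y j * (k == j)%:R) eq_sym jk mulr0.
rewrite big_seq big1// => j jr; rewrite -[LHS]/(y j * (k == j)%:R).
by case: eqVneq jr kr => [->->|_]; rewrite ?mulr0.
Qed.

End DotProduct.

(** * Summands of powers of a slender connected ring *)

Section SlenderSummand.
Variables (R : comNzRingType) (M : lmodType R) (K : choiceType).
Hypotheses (noethR : noetherian R) (slR : slender R) (connR : connected_ring R).
Hypothesis nmK : ~ omega_measurable K.
Variables (f : M -> power R K) (p : power R K -> M).
Hypotheses (fl : linear f) (pl : linear p) (fK : cancel f p).

Let E y : power R K := f (p y).

Let El : linear E. Proof. by move=> a u v; rewrite /E pl fl. Qed.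

Let EE y : E (E y) = E y. Proof. by rewrite /E fK. Qed.

Let row k : power R K := fun j => E (std_vec R j) k.

Let Ek_linear k : linear (fun y => E y k : R^o).
Proof. by move=> a u v; rewrite El. Qed.

Lemma row_seq k : exists r : seq K, uniq r /\
  forall y, E y k = \sum_(j <- r) row k j * y j.
Proof.
have sk := slender_module_map (slender_module_regular slR) (@Ek_linear k).
have [r0 r0P] := slender_map_finite (@Ek_linear k) sk nmK.
pose r := undup r0; have ur : uniq r by exact: undup_uniq.
exists r; split=> // y.
have /eqP : E (y - \sum_(j <- r) y j *: std_vec R j) k = 0.
  apply: r0P => j jr; rewrite -[LHS]/(y j - (\sum_(j <- r) y j *: std_vec R j) j).
  by rewrite sum_std_vec// mem_undup jr subrr.
rewrite (linB _ _ (@Ek_linear k)) (lin_sum _ _ (@Ek_linear k)).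
rewrite subr_eq0 => /eqP ->; apply: eq_bigr => j _.
by rewrite (linZ _ _ (@Ek_linear k)) mulrC.
Qed.

Lemma row_fin_supp k : fin_supp (row k).
Proof.
have [r [ur rE]] := row_seq k; apply: (@seq_fin_supp _ _ _ r) => j jr.
rewrite /row rE big_seq big1// => i ir; rewrite /std_vec.
by case: eqVneq ir jr => [->->|_]; rewrite ?mulr0.
Qed.

Lemma dotp_row k y : dotp (row k) y = E y k.
Proof.
have [r [ur rE]] := row_seq k; rewrite (dotpE _ ur) ?rE// => j jr.
rewrite /row rE big_seq big1// => i ir; rewrite /std_vec.
by case: eqVneq ir jr => [->->|_]; rewrite ?mulr0.
Qed.

(* The row space of the idempotent matrix [row], that is the predual of [M]. *)
Let P : set (power R K) :=
  [set x | fin_supp x /\ forall y, dotp x (E y) = dotp x y].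

(** Membership in [P] means that [x] is fixed by the matrix acting from the right, that is, [x] is
    the combination of the rows with its own entries as coefficients. *)
Lemma row_dual_basis : dual_basis [set 0] P row (fun k x => x k : R^o).
Proof.
have s0 : submodule [set 0 : power R K].
  by apply/submoduleP; split=> // a u v -> ->; rewrite scaler0 addr0.
have sP : submodule P.
  apply/submoduleP; split.
    have f0 := submod0 (@fin_supp_submod R K).
    by split=> // y; rewrite !dotp0l.
  move=> a u v [fu uP] [fv vP]; split; first exact: submod_lin (fin_supp_submod _ _) fu fv.
  by move=> y; rewrite !dotp_linearl// uP vP.
split=> //.
- by move=> _ ->; exact: submod0 sP.
- by move=> k; split=> [|y]; [exact: row_fin_supp|rewrite !dotp_row EE].
- by move=> k; split=> // u ->.
- move=> x [fx xP]; have [r [ur xr]] := fin_suppP fx; exists r; split=> //.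
  apply/eqP; rewrite subr_eq0; apply/eqP/funext => j.
  by rewrite fct_sumE -dotp_std_vec -xP (dotpE _ ur).
Qed.

(** If only finitely many columns were nonzero, [E] would factor through those coordinates, and the
    images under [p] of their unit vectors would generate [M]. *)
Lemma row_space_infinite : ~ fin_gen M ->
  infinite_set [set k | exists2 x, P x & x k <> 0].
Proof.
move=> nM fin; apply: nM; have [D0 D0E] := (finite_seqP _).1 fin.
pose D := undup D0; have uD : uniq D by exact: undup_uniq.
have rowD k j : j \notin D -> row k j = 0.
  rewrite mem_undup => jD; apply: contrapT => rkj.
  have : [set k | exists2 x, P x & x k <> 0] j.
    by exists (row k) => //; exact: db_gen row_dual_basis k.
  by rewrite D0E /= (negbTE jD).
exists (size D), (fun i => p (std_vec R (tnth (in_tuple D) i))).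
apply/seteqP; split=> // m _; exists (fun i => f m (tnth (in_tuple D) i)) => //.
rewrite -(big_tnth _ _ D xpredT (fun j => f m j *: p (std_vec R j))).
transitivity (p (\sum_(j <- D) f m j *: std_vec R j)).
  by rewrite lin_sum//; apply: eq_bigr => j _; rewrite linZ.
rewrite -[RHS]fK -[LHS]fK; congr p; rewrite -[RHS](congr1 f (fK m)).
rewrite -/(E _) -/(E (f m)); apply/funext => k.
rewrite -!dotp_row !(dotpE _ uD (rowD k)) big_seq [RHS]big_seq.
by apply: eq_bigr => j jD; rewrite sum_std_vec// jD.
Qed.

(** The isomorphism pairs [f m] with a basis [X] of [P]. It is injective because the entries of
    [f m] are its pairings with the rows, which lie in the span of [X]. *)
Lemma slender_summand_iso_power : ~ fin_gen M ->
  exists mu : Type, module_iso M (power R mu).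
Proof.
move=> /row_space_infinite Pinf.
have [X [XP iX PX]] := big_projective_free row_dual_basis noethR connR Pinf.
have rowP k : P (row k) by exact: db_gen row_dual_basis k.
have fE m : f m = E (f m) by rewrite /E fK.
exists (set_type X).
pose T (m : M) : power R (set_type X) := fun z => dotp (val z) (f m).
have Tl : linear T.
  move=> a u v; apply/funext => z; rewrite /T fl dotp_linearr//.
  by have [] := XP _ (set_valP z).
have T0 m : T m = 0 -> m = 0.
  move=> Tm; rewrite -(fK m) (_ : f m = 0) ?lin0//; apply/funext => k.
  rewrite fE -dotp_row.
  pose A : set (power R K) := [set x | fin_supp x /\ dotp x (f m) = 0].
  suff [] : A (row k) by [].
  apply: (lspan_min _ _ (PX _ (rowP k))).
    apply/submoduleP; split.
      have f0 := submod0 (@fin_supp_submod R K); split=> //.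
      exact: dotp0l.
    move=> a u v [fu u0] [fv v0]; split.
      exact: submod_lin (fin_supp_submod _ _) fu fv.
    by rewrite dotp_linearl// u0 v0 mulr0 addr0.
  move=> x Xx; split; first by have [] := XP _ Xx.
  by have := congr1 (fun y => y (SigSub (mem_set Xx))) Tm.
have Tsurj (c : power R (set_type X)) : exists m, T m = c.
  pose c' (x : power R K) : R^o :=
    if pselect (X x) is left Xx then c (SigSub (mem_set Xx)) else 0.
  have [h [hl hc]] := indep_extend c' iX.
  have h0 : h 0 = 0.
    have s0 := submod0 (lspan_submod X).
    have := hl (-1) 0 0 s0 s0.
    by rewrite scaler0 addr0 scaleN1r addNr.
  have hsum (r : seq K) (d : K -> R) :
      h (\sum_(k <- r) d k *: row k) = \sum_(k <- r) d k * h (row k).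
    suff [] : lspan X (\sum_(k <- r) d k *: row k) /\
        h (\sum_(k <- r) d k *: row k) = \sum_(k <- r) d k * h (row k) by [].
    elim: r => [|k r [IHX IH]].
      by rewrite !big_nil; split=> //; exact: submod0 (lspan_submod X).
    rewrite !big_cons hl ?IH//; last exact: PX.
    by split=> //; apply: (submod_lin _ (lspan_submod X)) => //; exact: PX.
  (* The vector representing the functional [h] on [P]: pairing with it gives [h], and evaluating at
     the rows shows that [E] fixes it, so it comes from [M]. *)
  pose y : power R K := fun k => h (row k).
  have xy x : P x -> dotp x y = h x.
    move=> Px; have [r [ur xr E0]] := db_expand row_dual_basis Px.
    rewrite (dotpE _ ur xr) -hsum; congr h.
    by apply/esym/eqP; rewrite -subr_eq0; apply/eqP.
  have Ey : E y = y by apply/funext => k; rewrite -dotp_row xy.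
  exists (p y); apply/funext => z; rewrite /T -/(E y) Ey xy; last first.
    by apply: XP; exact: set_valP.
  rewrite hc; last exact: set_valP.
  rewrite /c'; case: pselect => [Xz|[]]; last exact: set_valP.
  by congr c; exact: val_inj.
have [g gT] := choice Tsurj.
have [F FT] := linear_pack Tl.
exists F; rewrite FT; exists g => // m.
apply/eqP; rewrite -subr_eq0; apply/eqP; apply: T0.
by rewrite linB// gT subrr.
Qed.

End SlenderSummand.

Theorem theorem7p19 (R : comNzRingType) (M : lmodType R) (kappa lambda : Type) :
  noetherian R ->
  ~ omega_measurable R ->
  (w_slender R ->
   iso_to_direct_summand (direct_sum R lambda) (power R kappa) ->
   finite_set [set: lambda])
  /\
  (slender R ->
   connected_ring R ->
   ~ omega_measurable kappa ->
   ~ fin_gen M ->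
   iso_to_direct_summand M (power R kappa) ->
   exists mu : Type, module_iso M (power R mu)).
Proof.
move=> noethR nmR; split; first exact: direct_sum_summand_finite.
move=> slR connR nmK nM /summand_retraction[f [p [fl pl fK]]].
(* The alias [{classic kappa}] gives the index type the choice structure that the finitely supported
   sums require. *)
exact: (@slender_summand_iso_power R M {classic kappa} noethR slR connR nmK
  f p fl pl fK nM).
Qed.
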